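(* Let $L$ be a rectifiable link in $\mathbb{R}^3$. If $L$ is strongly critical for the Gehring problem (minimizing length subject to a lower bound on link-thickness), then $L$ has finite total curvature.
   Context: A curve is a continuous map $M\to\mathbb{R}^3$ from a compact oriented 1-manifold with boundary (finitely many components), up to orientation-preserving reparametrization. A link is a closed curve (all components of $M$ are circles) whose different components have disjoint images (a component may intersect itself). A rectifiable curve has finite length and is parametrized by arclength $s$; $T=dL/ds$ is its unit tangent, defined a.e. The link-thickness $\mathrm{LThi}(L)$ is the minimum distance between points on different components of $L$. $\mathrm{VF}^\infty(L)$ is the space of $\mathbb{R}^3$-valued vector fields along $L$ that are smooth functions of arclength. The first variation of length is $\delta_\xi\mathrm{Len}(L)=\int_L\langle T,d\xi/ds\rangle\,ds$, and $\delta^+_\xi\mathrm{LThi}(L)=\frac{d}{dt^+}\big|_{t=0}\mathrm{LThi}(L+t\xi)$ is the one-sided first variation of link-thickness. $L$ is strongly critical if there is $\varepsilon>0$ such that $\delta^+_\xi\mathrm{LThi}(L)\le-\varepsilon$ for all $\xi\in \mathrm{VF}^\infty(L)$ with $\delta_\xi\mathrm{Len}(L)=-1$. The total curvature of a polygon is the sum of its exterior turning angles; the total curvature of a curve is the supremum of the total curvatures of its inscribed polygons. A rectifiable curve has finite total curvature iff $T$ is (a.e. equal to) a function of bounded variation of arclength. *)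

(* Defs.v *)
From HB Require Import structures.
From mathcomp Require Import all_boot all_order all_algebra.
From mathcomp Require Import all_classical all_reals all_analysis.
Set Implicit Arguments.
Unset Strict Implicit.
Unset Printing Implicit Defensive.
Import Order.TTheory GRing.Theory Num.Theory.
Import numFieldNormedType.Exports.
Local Open Scope classical_set_scope.
Local Open Scope ring_scope.

(* The library norm on 'rV[R]_3 is the sup norm (same topology); lengths,
   distances and angles below use the Euclidean norm [enorm]. *)
Definition dotv (R : realType) (u v : 'rV[R]_3) : R :=
  \sum_(j < 3) u ord0 j * v ord0 j.

Definition enorm (R : realType) (v : 'rV[R]_3) : R := Num.sqrt (dotv v v).

Definition vangle (R : realType) (u v : 'rV[R]_3) : R :=
  acos (dotv u v / (enorm u * enorm v)).

(* A closed curve with k components; the i-th circle is R / (len i) Z, so that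
   maps on it are (len i)-periodic maps on R. *)
Record closed_curve (R : realType) (k : nat) := ClosedCurve {
  len : 'I_k -> R ;
  comp : 'I_k -> R -> 'rV[R]_3 ;
  len_gt0 : forall i, 0 < len i ;
  comp_continuous : forall i, continuous (comp i) ;
  comp_periodic : forall i, periodic (comp i) (len i) }.

Definition is_link (R : realType) (k : nat) (L : closed_curve R k) : Prop :=
  forall i j : 'I_k, i != j -> forall s t : R, comp L i s <> comp L j t.

Definition arc_length (R : realType) (f : R -> 'rV[R]_3) (a b : R) : \bar R :=
  ereal_sup [set (\sum_(0 <= n < size s)
                    enorm (f (nth b (a :: s) n.+1) - f (nth b (a :: s) n)))%:E
            | s in itv_partition a b].

(* In particular component i has finite length [len L i]. *)
Definition rectifiable_by_arclength (R : realType) (k : nat)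
    (L : closed_curve R k) : Prop :=
  forall (i : 'I_k) (a b : R), a <= b ->
    arc_length (comp L i) a b = (b - a)%:E.

(* T = dL/ds; takes a default value on the null set where L is not
   differentiable. *)
Definition unit_tangent (R : realType) (k : nat) (L : closed_curve R k)
    (i : 'I_k) : R -> 'rV[R]_3 := derive1 (comp L i).

(* Link-thickness, for a family of maps so that it applies to L + t xi.  The
   minimum is attained for closed curves.  With fewer than two components it
   is [inf set0 = 0] for every curve, so that its variations all vanish. *)
Definition LThi (R : realType) (k : nat) (f : 'I_k -> R -> 'rV[R]_3) : R :=
  inf [set d : R | exists i j : 'I_k, i != j /\
                   exists s t : R, d = enorm (f i s - f j t)].

(* VF^oo(L) *)
Definition smooth_field (R : realType) (k : nat) (L : closed_curve R k)
    (xi : 'I_k -> R -> 'rV[R]_3) : Prop :=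
  forall i : 'I_k, periodic (xi i) (len L i) /\
    forall (n : nat) (s : R), derivable (derive1n n (xi i)) s 1.

Definition var_len (R : realType) (k : nat) (L : closed_curve R k)
    (xi : 'I_k -> R -> 'rV[R]_3) : R :=
  \sum_(i < k) Rintegral (@lebesgue_measure R) `[0, len L i]
    (fun s => dotv (unit_tangent L i s) (derive1 (xi i) s)).

Definition var_LThi (R : realType) (k : nat) (L : closed_curve R k)
    (xi : 'I_k -> R -> 'rV[R]_3) : R :=
  lim ((fun t : R =>
          (LThi (fun i s => comp L i s + t *: xi i s) - LThi (comp L)) / t)
       @ 0^'+).

Definition strongly_critical (R : realType) (k : nat) (L : closed_curve R k) :
    Prop :=
  exists2 eps : R, 0 < eps &
    forall xi : 'I_k -> R -> 'rV[R]_3, smooth_field L xi ->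
      var_len L xi = -1 -> var_LThi L xi <= - eps.

(* Edges p_(i+1) - p_i of the closed polygon with vertices p, taken
   cyclically. *)
Definition edges (R : realType) (p : seq 'rV[R]_3) : seq 'rV[R]_3 :=
  [seq q.2 - q.1 | q <- zip p (rot 1 p)].

Definition polygon_curvature (R : realType) (p : seq 'rV[R]_3) : R :=
  \sum_(q <- zip (edges p) (rot 1 (edges p))) vangle q.1 q.2.

(* Closed polygons inscribed in a loop f of period l: the vertices are points
   of f in cyclic order, starting the enumeration in [0, l[.  Consecutive
   vertices are required to be distinct, so that all turning angles are
   defined. *)
Definition inscribed_polygons (R : realType) (f : R -> 'rV[R]_3) (l : R) :
    set (seq 'rV[R]_3) :=
  [set p | exists s : seq R,
     [/\ sorted <%R s, {in s, forall x, 0 <= x < l}, p = [seq f x | x <- s]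
       & 0 \notin edges p]].

Definition total_curvature (R : realType) (k : nat) (L : closed_curve R k) :
    \bar R :=
  (\sum_(i < k) ereal_sup [set (polygon_curvature p)%:E
                          | p in inscribed_polygons (comp L i) (len L i)])%E.

(* Main.v *)
Require Import Defs.
From HB Require Import structures.
From mathcomp Require Import all_boot all_order all_algebra.
From mathcomp Require Import all_classical all_reals all_analysis.
From mathcomp Require Import measurable_realfun ring lra.

(** Strong criticality bounds the first variation of length by the sup norm of
    the deformation. Indeed, moving L by t xi changes the distance of two points
    by at most 2 t sup |xi|, so the link-thickness, an infimum of distances,
    varies at a rate at least - 2 sup |xi|. If the length varies at the rate -1,
    strong criticality gives eps <= 2 sup |xi|; by homogeneity, the first
    variation of length is at most (2 / eps) sup |xi| in absolute value for
    every smooth xi ([strongly_critical_weakBV]). This says that the unit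
    tangent has bounded variation in the sense of distributions.

    The rest of the proof derives from this weak bound a bound on the curvature
    of inscribed polygons. Let f be a coordinate of a component. It is
    Lipschitz, so it is derivable almost everywhere and is the integral of its
    derivative ([lipschitz_density]). Integration by parts turns the weak bound
    into one on the integral of f xi'', where xi can be chosen such that xi'' is
    a combination of smooth approximations of Dirac masses. In the limit the
    slopes of chords of f, compared on pairs of intervals in windows that cover
    the circle twice, differ by a bounded amount in total ([slope_variation]).

    For a polygon inscribed in the component, consider the mean m of the unit
    tangent along the arc under each edge; it has the direction of the edge. As
    long as two consecutive means have norm at least 1/2, the angle between them
    is controlled by their distance. When m has norm less than 1/2, the tangent
    must turn a lot along that single arc: since the arc is parametrized by arc
    length, it has a subarc whose mean tangent has norm at least 3/4
    ([steep_subarc]), hence at distance at least 1/4 from m. There is thus a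
    bounded number of such edges, and they contribute at most pi to each of two
    angles. Both contributions are sums of differences of slopes, so they are
    bounded independently of the polygon ([polygon_curvature_bound]). *)

Set Implicit Arguments.
Unset Strict Implicit.
Unset Printing Implicit Defensive.
Import Order.TTheory GRing.Theory Num.Theory.
Import numFieldNormedType.Exports.
Local Open Scope classical_set_scope.
Local Open Scope ring_scope.

(** * Almost everywhere equal functions have equal integrals *)
Section integral_ae.
Context d (T : measurableType d) (R : realType).
Variable mu : {measure set T -> \bar R}.
Local Open Scope ereal_scope.
Import HBNNSimple.

Lemma ge0_le_integralT (f g : T -> \bar R) :
  (forall x, 0 <= f x) -> (forall x, f x <= g x) ->
  \int[mu]_x f x <= \int[mu]_x g x.
Proof.
move=> f0 fg; rewrite !ge0_integralTE//; last first.
  by move=> x; exact: le_trans (f0 x) (fg x).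
apply: ereal_sup_le => _ [h hf <-]; exists h => // x.
exact: le_trans (hf x) (fg x).
Qed.

(** A simple function below f can be set to zero on a null set without changing
    its integral; this passes to the supremum that defines the integral of f. *)
Lemma ge0_integral_setC_null (N : set T) (f : T -> \bar R) :
  measurable N -> mu N = 0 -> (forall x, 0 <= f x) ->
  \int[mu]_x f x = \int[mu]_x (f \_ (~` N)) x.
Proof.
move=> mN N0 f0.
have fN0 x : 0 <= (f \_ (~` N)) x by rewrite patchE; case: ifP.
apply/eqP; rewrite eq_le; apply/andP; split; last first.
  by apply: ge0_le_integralT => // x; rewrite patchE; case: ifP.
rewrite [X in X <= _]ge0_integralTE//; apply: ge_ereal_sup => _ [h hf <-].
have mCN : measurable (~` N) by exact: measurableC.
rewrite -integralT_nnsfun (@ge0_negligible_integral _ _ _ mu setT N)//.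
- rewrite setTD integral_mkcond; apply: ge0_le_integralT => x.
    by rewrite patchE; case: ifP => // _; rewrite lee_fin.
  by rewrite !patchE; case: ifP => // _; exact: hf.
- exact/measurable_EFinP.
- by move=> x _; rewrite lee_fin.
Qed.

(** The unit tangent has a default value where the curve is not derivable, so it
    is only known to agree almost everywhere with a measurable function. The
    equality of integrals is therefore read off from the definition by simple
    functions. *)
Lemma eq_integral_ae (D : set T) (f g : T -> \bar R) :
  (\forall x \ae mu, D x -> f x = g x) ->
  \int[mu]_(x in D) f x = \int[mu]_(x in D) g x.
Proof.
move=> [N [mN N0 fgN]].
have E x : ~ N x -> (f \_ D) x = (g \_ D) x.
  move=> Nx; rewrite !patchE; case: ifPn => //; rewrite inE => Dx.
  by apply: contrapT => fgx; apply: Nx; apply: fgN => /= /(_ Dx).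
rewrite integral_mkcond [RHS]integral_mkcond.
rewrite integralE [RHS]integralE; congr (_ - _).
- rewrite (ge0_integral_setC_null mN N0)// [RHS](ge0_integral_setC_null mN N0)//.
  apply: eq_integral => x _; rewrite !(patchE _ (~` N)); case: ifPn => //.
  by rewrite inE => /E; rewrite !funeposE => ->.
- rewrite (ge0_integral_setC_null mN N0)// [RHS](ge0_integral_setC_null mN N0)//.
  apply: eq_integral => x _; rewrite !(patchE _ (~` N)); case: ifPn => //.
  by rewrite inE => /E; rewrite !funenegE => ->.
Qed.

End integral_ae.

(** * The fundamental theorem of calculus for Lipschitz functions *)
Section lipschitz_ftc.
Context {R : realType}.
Notation mu := (@lebesgue_measure R).

Lemma lebesgue_stieltjes_itvoc (f : cumulative R R) (a b : R) : a <= b ->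
  lebesgue_stieltjes_measure f `]a, b]%classic = (f b - f a)%:E.
Proof.
move=> ab; rewrite /lebesgue_stieltjes_measure /measure_extension/=.
rewrite measurable_mu_extE/=; last exact: is_ocitv.
rewrite wlength_itv/= lte_fin; have [_|ba] := ltP a b; first by [].
by have -> : a = b; [apply/eqP; rewrite eq_le ab ba|rewrite subrr].
Qed.

(** The Stieltjes measures of f and g add up to K times the Lebesgue measure,
    because the two agree on intervals; so each of them vanishes on null sets. *)
Lemma lebesgue_stieltjes_dominated (f g : cumulative R R) (K : R) : 0 <= K ->
  (forall x, f x + g x = K * x) -> lebesgue_stieltjes_measure f `<< mu.
Proof.
move=> K0 fgK; apply/null_content_dominatesP => A mA A0.
pose nu := measure_add (lebesgue_stieltjes_measure f)
                       (lebesgue_stieltjes_measure g).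
have hom : {homo (fun x : R => K * x) : x y / x <= y}.
  by move=> x y xy; exact: ler_wpM2l.
have rc : right_continuous (fun x : R => K * x).
  apply/right_continuousW => x; exact: mulrl_continuous.
pose k : cumulative R R :=
  HB.pack (fun x : R => K * x) (isCumulative.Build R _ R _ hom rc).
have E1 X : ocitv X -> lebesgue_stieltjes_measure k X = nu X.
  case/ocitvP=> [->|[[a b]/= ab ->]]; first by rewrite !measure0.
  rewrite /nu measure_addE (lebesgue_stieltjes_itvoc k (ltW ab)).
  transitivity ((f b - f a)%:E + (g b - g a)%:E)%E; last first.
    by congr (_ + _)%E; apply/esym/lebesgue_stieltjes_itvoc/ltW.
  by rewrite -EFinD; congr EFin; rewrite addrACA fgK -opprD fgK.
pose Kn : {nonneg R} := NngNum K0.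
have E2 X : ocitv X -> lebesgue_stieltjes_measure k X = mscale Kn mu X.
  case/ocitvP=> [->|[[a b]/= ab ->]]; first by rewrite !measure0.
  rewrite /mscale lebesgue_stieltjes_itvoc ?ltW//=.
  by rewrite lebesgue_measure_itv/= lte_fin ab -EFinD -EFinM mulrBr.
have H1 : lebesgue_stieltjes_measure k A = nu A.
  exact: (@lebesgue_stieltjes_measure_unique _ _ nu E1 A mA).
have H2 : lebesgue_stieltjes_measure k A = mscale Kn mu A.
  exact: (@lebesgue_stieltjes_measure_unique _ _ (mscale Kn mu) E2 A mA).
have : nu A = 0%E by rewrite -H1 H2 /mscale; move: A0 => /= ->; rewrite mule0.
rewrite /nu measure_addE => /eqP.
by rewrite padde_eq0// => /andP[/eqP].
Qed.

Lemma lipschitz_continuous (h : R -> R) (K : R) :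
  (forall x y, `|h x - h y| <= K * `|x - y|) -> continuous h.
Proof.
move=> hK x; apply/cvgrPdist_lt => e e0.
near=> y; apply: le_lt_trans (hK x y) _.
have K1 : 0 < `|K| + 1 by rewrite ltr_wpDl.
apply: (@le_lt_trans _ _ ((`|K| + 1) * `|x - y|)).
  by rewrite ler_wpM2r// (le_trans (ler_norm _))// lerDl.
rewrite mulrC -ltr_pdivlMr//.
near: y; apply: cvgr_dist_lt; [exact: cvg_id|exact: divr_gt0].
Unshelve. all: by end_near. Qed.

(** Both K x + h x and K x - h x are nondecreasing, with sum 2 K x, so the
    Stieltjes measure of the former has a Radon-Nikodym density, which Lebesgue's
    differentiation theorem identifies with its derivative. *)
Lemma lipschitz_density (h : R -> R) (K a b : R) : a < b ->
  (forall x y, `|h x - h y| <= K * `|x - y|) ->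
  exists rho : R -> R,
  [/\ mu.-integrable `[a, b] (EFin \o rho),
      forall c, a <= c <= b -> \int[mu]_(x in `[a, c]) rho x = h c - h a &
      {ae mu, forall x, a < x < b -> derivable h x 1 /\ derive1 h x = rho x}].
Proof.
move=> ab hK.
have K0 : 0 <= K by have := hK 1 0; rewrite subr0 normr1 mulr1; apply: le_trans.
have ch := lipschitz_continuous hK.
have mon (s : R) : `|s| = 1 -> {homo (fun x => K * x + s * h x) : x y / x <= y}.
  move=> s1 x y xy; rewrite -subr_ge0.
  have := hK y x; rewrite (ger0_norm (_ : 0 <= y - x)) ?subr_ge0//.
  have := ler_norm (- s * (h y - h x)); rewrite normrM normrN s1 mul1r; lra.
have rc (s : R) : right_continuous (fun x => K * x + s * h x).
  apply/right_continuousW => x; apply: cvgD; first exact: mulrl_continuous.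
  by apply: cvgM; [exact: cvg_cst|exact: ch].
pose f : cumulative R R := HB.pack (fun x => K * x + 1 * h x)
  (isCumulative.Build R _ R _ (mon 1 (normr1 _)) (rc 1)).
have nN1 : `|-1 : R| = 1 by rewrite normrN1.
pose g : cumulative R R := HB.pack (fun x => K * x + (-1) * h x)
  (isCumulative.Build R _ R _ (mon (-1) nN1) (rc (-1))).
have fg x : f x + g x = (2 * K) * x by rewrite /f /g/=; ring.
have dom := lebesgue_stieltjes_dominated (mulr_ge0 (ler0n _ 2) K0) fg.
have mab : measurable (`]a, b]%classic : set (measurableTypeR R)).
  exact: measurable_itv.
have fin : (lebesgue_stieltjes_measure f `]a, b]%classic < +oo)%E.
  by rewrite lebesgue_stieltjes_itvoc ?ltW ?ltry.
pose nu : {finite_measure set _ -> \bar R} := mfrestr mab fin.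
have dom' : nu `<< mu.
  apply/null_content_dominatesP => A mA A0; rewrite /nu/= /mfrestr /mrestr.
  move/null_content_dominatesP: dom; apply; first exact: measurableI.
  apply/eqP; rewrite eq_le measure_ge0 andbT -[leRHS]A0.
  apply: le_measure; rewrite ?inE//. exact: measurableI.
have [r [r0 rfin ri rE]] := radon_nikodym_sigma_finite dom'.
pose rho1 x := fine (r x).
have rho1E : EFin \o rho1 = r by apply/funext => x; rewrite /rho1/= fineK.
have i1 : mu.-integrable [set: R] (EFin \o rho1) by rewrite rho1E.
have I1 c : a <= c <= b -> \int[mu]_(x in `[a, c]) rho1 x = f c - f a.
  case/andP=> ac cb; rewrite -Rintegral_itv_obnd_cbnd; last first.
    by apply: (integrableS measurableT) i1 => //; exact: measurable_itv.
  rewrite /Rintegral.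
  have -> : (\int[mu]_(x in `]a, c]) (rho1 x)%:E = nu `]a, c]%classic)%E.
    rewrite rE; last exact: measurable_itv.
    by apply: eq_integral => x _; rewrite /rho1 fineK.
  rewrite /nu/= /mfrestr/mrestr setIidl; last first.
    by apply: subset_itvl; rewrite bnd_simp.
  by rewrite lebesgue_stieltjes_itvoc.
have Kint c : mu.-integrable `[a, c] (EFin \o cst K).
  apply: continuous_compact_integrable; first exact: segment_compact.
  by apply: continuous_subspaceT => x; exact: cvg_cst.
have i1S (A : set (measurableTypeR R)) : measurable A ->
    mu.-integrable A (EFin \o rho1).
  by move=> mA; exact: (integrableS measurableT).
(* rho1 is the derivative of K x + h x *)
exists (fun x => rho1 x - K); split.
- rewrite (_ : EFin \o _ = ((EFin \o rho1) \- (EFin \o cst K))%E)//.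
  by apply: integrableB => //; apply: i1S; exact: measurable_itv.
- move=> c /[dup] acb /andP[ac cb]; rewrite RintegralB//; last first.
    by apply: i1S; exact: measurable_itv.
  rewrite I1// Rintegral_cst//= lebesgue_measure_itv/= lte_fin.
  have [_|ca] := ltP a c.
    by rewrite -EFinD/=; ring.
  have -> : c = a by apply/eqP; rewrite eq_le ac ca.
  by rewrite mulr0 !subrr.
- have loc : locally_integrable [set: R] rho1.
    by apply: open_integrable_locally => //; exact: openT.
  have := @FTC1 _ rho1 (BLeft a) (fun y => i1S _ (measurable_itv _)) loc.
  apply: filterS; first exact: (ae_filter_ringOfSetsType mu).
  move=> x /= + /andP[ax xb]; rewrite lte_fin => /(_ ax)[dF F'].
  set F := (fun x => _) in dF F'.
  have hF : \forall y \near x, F y - K * y + f a = h y.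
    near=> y; have : y \in `]a, b[.
      by near: y; apply: near_in_itvoo; rewrite in_itv/= ax xb.
    rewrite in_itv/= => /andP[ay yb].
    by rewrite /F I1 ?ltW//; rewrite /f/=; ring.
  have dh : is_derive x 1 (fun y => F y - K * y + f a) (rho1 x - K).
    have dF1 : is_derive x 1 F (rho1 x).
      by apply: (DeriveDef dF); rewrite -derive1E.
    by apply: is_derive_eq; rewrite /GRing.scale/= mulr1 addr0.
  have /(near_eq_is_derive hF) dh' := dh.
  by split; [exact: ex_derive|rewrite derive1E; exact: derive_val].
Unshelve. all: by end_near. Qed.
End lipschitz_ftc.

(** * Integration by parts and periodic functions *)
Section by_parts.
Context {R : realType}.
Notation mu := (@lebesgue_measure R).

Lemma ae_neq (c : R) : {ae mu, forall x, x != c}.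
Proof.
exists [set c]; split; [exact: measurable_set1|exact: lebesgue_measure_set1|].
by move=> x /= /negP; rewrite negbK => /eqP.
Qed.

Lemma ae_itvcc (P : R -> Prop) (a b : R) :
  {ae mu, forall x, a < x < b -> P x} -> {ae mu, forall x, `[a, b]%classic x -> P x}.
Proof.
move=> h.
have F := ae_filter_ringOfSetsType mu.
have h2 := @filterI _ _ F _ _ (ae_neq a) (ae_neq b).
have := @filterI _ _ F _ _ h h2.
apply: filterS => x /= [hx [xa xb]]; rewrite in_itv/= => /andP[ax bx].
by apply: hx; rewrite !lt_neqAle ax bx (eq_sym a) xa xb.
Qed.

Lemma derivable_bounded_lipschitz (phi dphi : R -> R) (M : R) :
  (forall x : R, is_derive x 1 phi (dphi x)) -> (forall x, `|dphi x| <= M) ->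
  forall x y, `|phi x - phi y| <= M * `|x - y|.
Proof.
move=> dp dM x y; wlog : x y / x <= y.
  move=> H; have [/H//|/ltW/H] := leP x y.
  by rewrite distrC (distrC y).
rewrite le_eqVlt => /predU1P[->|xy]; first by rewrite !subrr normr0 mulr0.
have [] := @MVT _ phi dphi x y xy (fun z _ => dp z).
  by apply: derivable_within_continuous => z _; exact: ex_derive.
move=> z _ E; rewrite distrC E normrM (distrC x).
by rewrite ler_wpM2r.
Qed.

(** The product of f and phi is again Lipschitz, so the integral of its
    derivative over [0, l] is its increment, which is zero. Here T stands for a version of the
    derivative of f, such as a coordinate of the unit tangent. *)
Lemma lipschitz_by_parts (f phi dphi T : R -> R) (l K M M1 M2 : R) : 0 < l ->
  (forall x y, `|f x - f y| <= K * `|x - y|) -> (forall x, `|f x| <= M) ->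
  (forall x : R, is_derive x 1 phi (dphi x)) -> continuous dphi ->
  (forall x, `|phi x| <= M1) -> (forall x, `|dphi x| <= M2) ->
  f l * phi l = f 0 * phi 0 ->
  {ae mu, forall x, 0 < x < l -> derivable f x 1 -> T x = derive1 f x} ->
  \int[mu]_(x in `[0, l]) (T x * phi x) =
  - \int[mu]_(x in `[0, l]) (f x * dphi x).
Proof.
move=> l0 fK fM dp cdp pM dpM bd TE.
have lip x y : `|f x * phi x - f y * phi y| <= (K * M1 + M * M2) * `|x - y|.
  have -> : f x * phi x - f y * phi y =
    (f x - f y) * phi x + f y * (phi x - phi y) by ring.
  rewrite (le_trans (ler_normD _ _))// !normrM mulrDl; apply: lerD.
    by rewrite mulrAC; apply: ler_pM => //; rewrite fK.
  rewrite -mulrA; apply: ler_pM => //.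
  exact: derivable_bounded_lipschitz.
have cf := lipschitz_continuous fK.
have [rf [_ _ df]] := lipschitz_density l0 fK.
have [rh [ih Ih dh]] := lipschitz_density l0 lip.
have cfd : mu.-integrable `[0, l] (EFin \o (fun x => f x * dphi x)).
  apply: continuous_compact_integrable; first exact: segment_compact.
  by apply: continuous_subspaceT => x; apply: cvgM; [exact: cf|exact: cdp].
have -> : \int[mu]_(x in `[0, l]) (T x * phi x) =
          \int[mu]_(x in `[0, l]) (rh x - f x * dphi x).
  rewrite /Rintegral; congr fine; apply: eq_integral_ae.
  apply: ae_itvcc.
  have F := ae_filter_ringOfSetsType mu.
  have := @filterI _ _ F _ _ TE (@filterI _ _ F _ _ df dh).
  apply: filterS => x /= [Tx [fx hx]] xl; congr EFin.
  have [dfx _] := fx xl; have [_ <-] := hx xl.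
  rewrite (Tx xl dfx) !derive1E.
  have {1}-> : (fun z => f z * phi z) = f * phi by [].
  rewrite (deriveM dfx (@ex_derive _ _ _ _ _ _ _ (dp x))).
  by rewrite (@derive_val _ _ _ _ _ _ _ (dp x)) /GRing.scale/=; ring.
rewrite (RintegralB _ ih cfd); last exact: measurable_itv.
by rewrite Ih ?lexx ?ltW//= bd; ring.
Qed.

Lemma modr_period (l : R) : 0 < l ->
  forall x, exists z : int, 0 <= x - z%:~R * l < l.
Proof.
move=> l0 x; exists (Num.floor (x / l)).
have /andP[] := floor_itv (x / l).
rewrite ler_pdivlMr// ltr_pdivrMr// intrD mulrDl mul1r => h1 h2.
by apply/andP; split; lra.
Qed.

Lemma periodic_int (V : zmodType) (f : R -> V) (l : R) : periodic f l ->
  forall (z : int) x, f (x - z%:~R * l) = f x.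
Proof.
move=> fl z x.
have Hn (n : nat) y : f (y + n%:R * l) = f y.
  elim: n => [|n IH]; first by rewrite mul0r addr0.
  by rewrite -natr1 mulrDl mul1r addrA fl.
case: z => n; rewrite -?pmulrn; first by rewrite -[in RHS](subrK (n%:R * l) x) Hn.
by rewrite NegzE mulrNz mulNr opprK Hn.
Qed.

Lemma periodic_continuous_bounded (f : R -> R) (l : R) : 0 < l ->
  periodic f l -> continuous f -> exists M, forall x, `|f x| <= M.
Proof.
move=> l0 fl cf.
have cn : {within `[0, l], continuous (fun x => `|f x|)}.
  apply: continuous_subspaceT => x.
  by apply: continuous_comp; [exact: cf|exact: norm_continuous].
have [c _ hc] := EVT_max (ltW l0) cn.
exists `|f c| => x; have [z /andP[z0 zl]] := modr_period l0 x.
rewrite -(periodic_int fl z); by apply: hc; rewrite in_itv/= z0 ltW.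
Qed.

End by_parts.

(** * Smooth functions *)
Section smooth_functions.
Context {R : realType}.

(** The regularity that [smooth_field] asks from each component of a field. *)
Definition smooth (V : normedModType R) (g : R -> V) :=
  forall (n : nat) (s : R), derivable (derive1n n g) s 1.

(** A class of derivable functions that is stable under derivation consists of
    smooth functions: this replaces the computation of iterated derivatives. *)
Lemma smooth_coind (V : normedModType R) (P : (R -> V) -> Prop) :
  (forall g, P g -> (forall s, derivable g s 1) /\ P (derive1 g)) ->
  forall g, P g -> smooth g.
Proof.
move=> HP g Pg n; elim: n g Pg => [|n IH] g /HP[dg Pg'] s; first exact: dg.
by rewrite derive1Sn; exact: IH.
Qed.

Lemma smoothP (V : normedModType R) (g : R -> V) : smooth g ->
  (forall s, derivable g s 1) /\ smooth (derive1 g).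
Proof.
move=> sg; split=> [s|n s]; first exact: (sg 0%N s).
by rewrite -derive1Sn; exact: sg.
Qed.

Lemma is_derive1E (V : normedModType R) (g : R -> V) (dg : R -> V) :
  (forall x : R, is_derive x 1 g (dg x)) -> derive1 g = dg.
Proof. by move=> h; apply/funext => x; rewrite derive1E; apply: derive_val. Qed.

Lemma is_deriveZ_row (m : nat) (g : R -> R) (dg : R) (v : 'rV[R]_m) (x : R) :
  is_derive x 1 g dg -> is_derive x 1 (fun s => g s *: v) (dg *: v).
Proof.
move=> Dg.
have D i j : is_derive x 1 (fun s => (g s *: v) i j) (dg * v i j).
  under eq_fun do rewrite mxE.
  by apply: is_derive_eq; rewrite scaler0 add0r /GRing.scale/= mulrC.
have dZ : derivable (fun s => g s *: v) x 1.
  by apply/derivable_mxP => i j; case: (D i j).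
apply: DeriveDef => //; rewrite derive_mx//.
by apply/matrixP => i j; rewrite !mxE; case: (D i j).
Qed.

Lemma smooth_is_derive (g : R -> R) : smooth g ->
  forall x : R, is_derive x 1 g (derive1 g x).
Proof.
by move=> /smoothP[dg _] x; apply: DeriveDef => //; rewrite derive1E.
Qed.

Lemma smoothZ_row (m : nat) (g : R -> R) (v : 'rV[R]_m) :
  smooth g -> smooth (fun s => g s *: v).
Proof.
move=> sg; pose P h := exists2 g : R -> R, smooth g & h = (fun s => g s *: v).
apply: (@smooth_coind _ P); last by exists g.
move=> _ [k sk ->].
have D (x : R) : is_derive x 1 (fun s => k s *: v) (derive1 k x *: v).
  by apply: is_deriveZ_row; exact: smooth_is_derive.
split; first by move=> s; case: (D s).
by exists (derive1 k); [case/smoothP : sk|exact: is_derive1E].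
Qed.

Lemma smooth_reflect (g : R -> R) (b : R) :
  smooth g -> smooth (fun t => g (b - t)).
Proof.
move=> sg; pose P h := exists k : R -> R, exists2 c, smooth k & h = (fun t => c * k (b - t)).
apply: (@smooth_coind _ P); last first.
  by exists g, 1 => //; apply/funext => t; rewrite mul1r.
move=> _ [k [c /smoothP[dk sk] ->]].
have D (x : R) : is_derive x 1 (fun t => c * k (b - t)) (- c * derive1 k (b - x)).
  have Dk : is_derive (b - x) 1 k (derive1 k (b - x)).
    by apply: DeriveDef => //; rewrite derive1E.
  apply: is_derive_eq.
  by rewrite /GRing.scale/=; ring.
split; first by move=> s; case: (D s).
by exists (derive1 k), (- c) => //; exact: is_derive1E.
Qed.

Lemma smooth_lin (c : R) (f g : R -> R) :
  smooth f -> smooth g -> smooth (fun x => c * f x + g x).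
Proof.
move=> sf sg.
pose P h := exists f g : R -> R, [/\ smooth f, smooth g & h = (fun x => c * f x + g x)].
apply: (@smooth_coind _ P); last by exists f, g.
move=> _ [h [k [/smoothP[dh sh] /smoothP[dk sk] ->]]].
have D (x : R) : is_derive x 1 (fun t => c * h t + k t) (c * derive1 h x + derive1 k x).
  have Dh : is_derive x 1 h (derive1 h x).
    by apply: DeriveDef => //; rewrite derive1E.
  have Dk : is_derive x 1 k (derive1 k x).
    by apply: DeriveDef => //; rewrite derive1E.
  exact: is_derive_eq.
split; first by move=> s; case: (D s).
by exists (derive1 h), (derive1 k); split => //; exact: is_derive1E.
Qed.

Lemma smooth_cst (c : R) : smooth (fun _ : R => c).
Proof.
pose P (h : R -> R) := exists a : R, h = (fun=> a).
apply: (@smooth_coind _ P); last by exists c.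
move=> _ [a ->]; split; first by move=> s; exact: derivable_cst.
by exists 0; apply/funext => x; rewrite derive1_cst.
Qed.

Lemma eq_smooth (f g : R -> R) : f =1 g -> smooth f -> smooth g.
Proof. by move=> /funext ->. Qed.

Lemma smooth_sum (I : Type) (r : seq I) (F : I -> R -> R) (c : I -> R) :
  (forall i, smooth (F i)) -> smooth (fun x => \sum_(i <- r) c i * F i x).
Proof.
move=> sF; elim: r => [|i r IH].
  by apply: (eq_smooth _ (@smooth_cst 0)) => x; rewrite big_nil.
by apply: (eq_smooth _ (@smooth_lin (c i) _ _ (sF i) IH)) => x; rewrite big_cons.
Qed.

Lemma is_derive_lincomb (I : Type) (r : seq I) (c : I -> R) (F dF : I -> R -> R) :
  (forall i (x : R), is_derive x 1 (F i) (dF i x)) ->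
  forall x : R, is_derive x 1 (fun x => \sum_(i <- r) c i * F i x)
                              (\sum_(i <- r) c i * dF i x).
Proof.
move=> DF x; elim: r => [|i r IH].
  by rewrite big_nil; under eq_fun do rewrite big_nil; exact: is_derive_cst.
rewrite big_cons; under eq_fun do rewrite big_cons.
have Di := DF i x; apply: is_derive_eq.
by rewrite /GRing.scale/=; ring.
Qed.

End smooth_functions.

(** * A kernel with explicit antiderivatives *)
Section kernel.
Context {R : realType}.

(** Spanned by cosines with an arbitrary phase, which include constants and
    sines. *)
Inductive trigpoly : (R -> R) -> Prop :=
| trigpoly_cos a b : trigpoly (fun x => cos (a * x + b))
| trigpoly_lin c g h : trigpoly g -> trigpoly h -> trigpoly (fun x => c * g x + h x).

(** Adding the powers of x makes the class stable under antiderivatives: a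
    nonzero constant, as a cosine of frequency zero, has none among [trigpoly]. *)
Inductive trigpolyX : (R -> R) -> Prop :=
| trigpolyX_cos a b : trigpolyX (fun x => cos (a * x + b))
| trigpolyX_pow n : trigpolyX (fun x => x ^+ n)
| trigpolyX_lin c g h :
  trigpolyX g -> trigpolyX h -> trigpolyX (fun x => c * g x + h x).

Lemma trigpolyW g : trigpoly g -> trigpolyX g.
Proof. by elim => *; [exact: trigpolyX_cos|exact: trigpolyX_lin]. Qed.

Lemma trigpolyX0 : trigpolyX (fun=> 0).
Proof.
rewrite [X in trigpolyX X](_ : _ = fun x => -1 * (x ^+ 0) + x ^+ 0).
  by apply: trigpolyX_lin; exact: trigpolyX_pow.
by apply/funext => x; rewrite mulN1r addNr.
Qed.

Lemma trigpolyXZ c g : trigpolyX g -> trigpolyX (fun x => c * g x).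
Proof.
move=> Eg; under eq_fun do rewrite -[_ * _]addr0.
exact: trigpolyX_lin Eg trigpolyX0.
Qed.

(** A product of two cosines is half the sum of the cosines of the sum and of
    the difference of their arguments. *)
Lemma trigpoly_mulcos w g : trigpoly g -> trigpoly (fun x => (1 + cos (w * x)) * g x).
Proof.
elim=> [a b|c h k _ IHh _ IHk]; last first.
  rewrite [X in trigpoly X](_ : _ = fun x => c * ((1 + cos (w * x)) * h x) +
     (1 + cos (w * x)) * k x); first exact: trigpoly_lin.
  by apply/funext => x; ring.
rewrite [X in trigpoly X](_ : _ = fun x => 2^-1 * cos ((a + w) * x + b) +
  (2^-1 * cos ((a - w) * x + b) + cos (a * x + b))).
  apply: (@trigpoly_lin _ (fun x => cos _)
    (fun x => 2^-1 * cos ((a - w) * x + b) + cos (a * x + b))).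
    exact: trigpoly_cos.
  by apply: (@trigpoly_lin _ (fun x => cos _) (fun x => cos _)); exact: trigpoly_cos.
apply/funext => x.
have -> : (a + w) * x + b = (a * x + b) + w * x by ring.
have -> : (a - w) * x + b = (a * x + b) - w * x by ring.
by move: (a * x + b) => u; rewrite cosD cosB; field.
Qed.

Lemma is_derive_expr (n : nat) (x : R) :
  is_derive x 1 (fun y : R => y ^+ n) (n%:R * x ^+ n.-1).
Proof.
apply: DeriveDef; first exact: exprn_derivable.
by rewrite exp_derive /GRing.scale/= mulr1.
Qed.

Lemma trigpolyX_derive g : trigpolyX g ->
  exists2 dg, trigpolyX dg & forall x : R, is_derive x 1 g (dg x).
Proof.
elim=> [a b|n|c h k _ [dh Eh Dh] _ [dk Ek Dk]].
- exists (fun x => a * cos (a * x + (b + pi / 2))); first exact/trigpolyXZ/trigpolyX_cos.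
  move=> x; apply: is_derive_eq.
  rewrite addrA cosDpihalf /GRing.scale/=; ring.
- exists (fun x => n%:R * x ^+ n.-1); first exact/trigpolyXZ/trigpolyX_pow.
  by move=> x; exact: is_derive_expr.
- by exists (fun x => c * dh x + dk x); [exact: trigpolyX_lin|move=> x; exact: is_derive_eq].
Qed.

Lemma trigpolyX_antiderive g : trigpolyX g ->
  exists2 G, trigpolyX G & forall x : R, is_derive x 1 G (g x).
Proof.
elim=> [a b|n|c h k _ [dh Eh Dh] _ [dk Ek Dk]].
- have [->|a0] := eqVneq a 0.
    exists (fun x => cos b * x ^+ 1); first exact/trigpolyXZ/trigpolyX_pow.
    move=> x; have D1 := is_derive_expr 1 x; apply: is_derive_eq.
    by rewrite /GRing.scale/= expr0 mul0r add0r; ring.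
  exists (fun x => a^-1 * cos (a * x + (b - pi / 2))); first exact/trigpolyXZ/trigpolyX_cos.
  move=> x; apply: is_derive_eq.
  by rewrite addrA sinBpihalf /GRing.scale/=; field.
- exists (fun x => (n.+1%:R)^-1 * x ^+ n.+1); first exact/trigpolyXZ/trigpolyX_pow.
  move=> x; have Dn := is_derive_expr n.+1 x; apply: is_derive_eq.
  by rewrite /GRing.scale/= mulrA mulVf ?mul1r// pnatr_eq0.
- by exists (fun x => c * dh x + dk x); [exact: trigpolyX_lin|move=> x; exact: is_derive_eq].
Qed.

Lemma trigpolyX_smooth g : trigpolyX g -> smooth g.
Proof.
apply: smooth_coind => {}g /trigpolyX_derive[dg Edg Dg].
by split=> [s|]; [case: (Dg s)|rewrite (is_derive1E Dg)].
Qed.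

(** Since 1 + cos (2 u) = 2 cos^2 u, this is the de la Vallee-Poussin kernel of
    period l, up to a factor. It is nonnegative, it concentrates at the
    multiples of l as N grows, and, being a trigonometric polynomial, it has
    smooth antiderivatives defined on the whole line. *)
Definition cosker (l : R) (N : nat) (x : R) : R :=
  (1 + cos (2 * pi / l * x)) ^+ N.

Lemma cosker_trigpoly l N : trigpoly (cosker l N).
Proof.
elim: N => [|N IH].
  rewrite /cosker [X in trigpoly X](_ : _ = fun x => cos (0 * x + 0)).
    exact: trigpoly_cos.
  by apply/funext => x; rewrite expr0 mul0r addr0 cos0.
rewrite /cosker; under eq_fun do rewrite exprS.
exact: trigpoly_mulcos.
Qed.

Lemma cosker_antiderivatives l N : exists A B : R -> R,
  [/\ smooth B, forall x : R, is_derive x 1 B (A x)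
    & forall x : R, is_derive x 1 A (cosker l N x)].
Proof.
have [A EA DA] := trigpolyX_antiderive (trigpolyW (cosker_trigpoly l N)).
have [B EB DB] := trigpolyX_antiderive EA.
by exists A, B; split => //; exact: trigpolyX_smooth.
Qed.

End kernel.

(** * Integrals of continuous functions *)
Section integrals_of_continuous_functions.
Context {R : realType}.
Notation mu := (@lebesgue_measure R).
Implicit Types g h : R -> R.

Lemma continuous_integrable g (a b : R) : continuous g ->
  mu.-integrable `[a, b] (EFin \o g).
Proof.
move=> cg; apply: continuous_compact_integrable; first exact: segment_compact.
exact: continuous_subspaceT.
Qed.

Lemma Rintegral_lin (c : R) g h (a b : R) : continuous g -> continuous h ->
  \int[mu]_(x in `[a, b]) (c * g x + h x) =
  c * \int[mu]_(x in `[a, b]) g x + \int[mu]_(x in `[a, b]) h x.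
Proof.
move=> cg ch.
have icg : mu.-integrable `[a, b] (EFin \o (fun x => c * g x)).
  by apply: continuous_integrable => x; apply: cvgM; [exact: cvg_cst|exact: cg].
rewrite (RintegralD _ icg (continuous_integrable a b ch)); last exact: measurable_itv.
by rewrite RintegralZl//; exact: continuous_integrable.
Qed.

Lemma Rintegral_sum (I : Type) (r : seq I) (c : I -> R) (F : I -> R -> R) (a b : R) :
  (forall i, continuous (F i)) ->
  \int[mu]_(x in `[a, b]) (\sum_(i <- r) c i * F i x) =
  \sum_(i <- r) c i * \int[mu]_(x in `[a, b]) F i x.
Proof.
move=> cF; have cS s : continuous (fun x => \sum_(i <- s) c i * F i x).
  elim: s => [|i s IH] x.
    by under eq_fun do rewrite big_nil; exact: cvg_cst.
  under eq_fun do rewrite big_cons.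
  by apply: cvgD; [apply: cvgM; [exact: cvg_cst|exact: cF]|exact: IH].
elim: r => [|i r IH].
  rewrite big_nil; under eq_Rintegral do rewrite big_nil.
  by rewrite Rintegral_cst ?mul0r//; exact: measurable_itv.
by under eq_Rintegral do rewrite big_cons; rewrite big_cons Rintegral_lin// IH.
Qed.

Lemma continuous_le_Rintegral g h (a b : R) : continuous g -> continuous h ->
  (forall x, a <= x <= b -> g x <= h x) ->
  \int[mu]_(x in `[a, b]) g x <= \int[mu]_(x in `[a, b]) h x.
Proof.
move=> cg ch gh; apply: le_Rintegral; [exact: measurable_itv|exact: continuous_integrable..|].
by move=> x /=; rewrite in_itv/=; exact: gh.
Qed.

Lemma is_derive_continuous g h : (forall x : R, is_derive x 1 g (h x)) ->
  continuous g.
Proof.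
by move=> D x; apply/differentiable_continuous/derivable1_diffP; case: (D x).
Qed.

Lemma Rintegral_derive g h (a b : R) : a < b -> continuous g ->
  (forall x : R, is_derive x 1 h (g x)) ->
  \int[mu]_(x in `[a, b]) g x = h b - h a.
Proof.
move=> ab cg D; have ch := is_derive_continuous D.
rewrite /Rintegral (@continuous_FTC2 _ g h a b)//.
- exact: continuous_subspaceT.
- split; [by move=> x _; case: (D x)| |].
  + exact/cvg_at_right_filter/ch.
  + exact/cvg_at_left_filter/ch.
- by move=> x _; rewrite (is_derive1E D).
Qed.

End integrals_of_continuous_functions.

(** * Concentration of the kernel *)
Section cosker_estimates.
Context {R : realType}.
Notation mu := (@lebesgue_measure R).
Variable l : R.
Hypothesis l0 : 0 < l.
Let w := 2 * pi / l.

Lemma cos_periodic x : cos (w * (x + l)) = cos (w * x).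
Proof.
rewrite mulrDr.
have -> : w * l = pi *+ 2 by rewrite /w mulfVK ?gt_eqF// mulr_natl.
by rewrite cosD2pi.
Qed.

Lemma cosker_periodic N : periodic (cosker l N) l.
Proof. by move=> x; rewrite /cosker cos_periodic. Qed.

Lemma cosker_ge0 N x : 0 <= cosker l N x.
Proof. by rewrite /cosker exprn_ge0// -lerBlDl sub0r cos_geN1. Qed.

Lemma cosker_continuous N : continuous (cosker l N).
Proof.
have [dg _ /is_derive_continuous] := trigpolyX_derive (trigpolyW (cosker_trigpoly l N)).
exact.
Qed.

Lemma continuous_reflect (g : R -> R) (b : R) : continuous g ->
  continuous (fun t => g (b - t)).
Proof.
move=> cg x; apply: (@continuous_comp _ _ _ (fun t => b - t)); last exact: cg.
by apply: cvgB; [exact: cvg_cst|exact: cvg_id].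
Qed.

Lemma is_derive_reflect (g h : R -> R) (b : R) :
  (forall x : R, is_derive x 1 h (g x)) ->
  forall x : R, is_derive x 1 (fun t => - h (b - t)) (g (b - x)).
Proof.
move=> D x; have Dh := D (b - x); apply: is_derive_eq.
by rewrite /GRing.scale/=; ring.
Qed.

(** Normalizing factor: the quotient of [smoothed N f b] by it is a weighted
    average of f. *)
Definition mass N : R := \int[mu]_(t in `[0, l]) cosker l N (0 - t).

Definition smoothed N (f : R -> R) (b : R) : R :=
  \int[mu]_(t in `[0, l]) (f t * cosker l N (b - t)).

(** The left-hand side has derivative zero, as the kernel is periodic. *)
Lemma antiderivative_increment N (A : R -> R) :
  (forall x : R, is_derive x 1 A (cosker l N x)) ->
  forall x, A (x + l) - A x = mass N.
Proof.
move=> DA.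
have massE : mass N = A 0 - A (0 - l).
  rewrite /mass (Rintegral_derive l0 _ (is_derive_reflect 0 DA)).
    by rewrite subr0; ring.
  exact/continuous_reflect/cosker_continuous.
move=> x; rewrite massE.
have := @is_derive_0_is_cst _ (fun x => A (x + l) - A x) x (- l).
rewrite addNr sub0r; apply => {}x.
apply: is_derive_eq.
by rewrite /GRing.scale/= (cosker_periodic N x); ring.
Qed.

Lemma smoothed_cst N b : \int[mu]_(t in `[0, l]) cosker l N (b - t) = mass N.
Proof.
have [A [B [_ _ DA]]] := cosker_antiderivatives l N.
rewrite (Rintegral_derive l0 _ (is_derive_reflect b DA)).
  by rewrite -(antiderivative_increment DA (b - l)) subrK subr0; ring.
exact/continuous_reflect/cosker_continuous.
Qed.

Lemma antiderivative_homo N (A : R -> R) :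
  (forall x : R, is_derive x 1 A (cosker l N x)) ->
  {homo A : x y / x <= y}.
Proof.
move=> DA x y; rewrite le_eqVlt => /predU1P[->//|xy].
have [] := @MVT _ A (cosker l N) x y xy (fun z _ => DA z).
  by apply: derivable_within_continuous => z _; case: (DA z).
move=> z _ E; rewrite -subr_ge0 E mulr_ge0 ?cosker_ge0// subr_ge0 ltW//.
Qed.

Lemma mass_gt0 N : 0 < mass N.
Proof.
have [A [B [_ _ DA]]] := cosker_antiderivatives l N.
have mA := antiderivative_homo DA.
rewrite -(antiderivative_increment DA 0) add0r.
have l4 : 0 < l / 4 by rewrite divr_gt0.
have [] := @MVT _ A (cosker l N) 0 (l / 4) l4 (fun z _ => DA z).
  by apply: derivable_within_continuous => z _; case: (DA z).
move=> z; rewrite in_itv/= => /andP[z0 z4] E.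
apply: (@lt_le_trans _ _ (A (l / 4) - A 0)); last first.
  by rewrite lerD2r mA//; move: (l0); lra.
rewrite E mulr_gt0 ?subr_gt0// exprn_gt0// -/w ltr_wpDr//.
apply: cos_ge0_pihalf.
have w0 : 0 < w by rewrite /w divr_gt0// mulr_gt0// pi_gt0.
apply/andP; split.
  by rewrite (@le_trans _ _ 0)// ?oppr_le0 ?divr_ge0 ?pi_ge0// mulr_ge0 ?ltW.
have -> : pi / 2 = w * (l / 4) by rewrite /w; field; rewrite gt_eqF.
by rewrite ler_wpM2l// ltW.
Qed.

Lemma is_derive_cosker N (x : R) : is_derive x 1 (cosker l N)
  (- N%:R * w * (sin (w * x) * (1 + cos (w * x)) ^+ N.-1)).
Proof.
have Dc : is_derive x 1 (fun y => 1 + cos (w * y)) (- (w * sin (w * x))).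
  by apply: is_derive_eq; rewrite /GRing.scale/=; ring.
have := @is_deriveX R _ _ N x 1 _ Dc.
have <- : cosker l N = (fun y => 1 + cos (w * y)) ^+ N.
  by apply/funext => y; rewrite exprfctE.
move=> D; apply: (@is_derive_eq _ _ _ _ _ _ _ _ D).
by rewrite /GRing.scale/=; ring.
Qed.

(** Over a period the derivative of sin (w x) (1 + cos (w x))^N has integral
    zero, which says that N (1 - cos (w x)) and cos (w x) have the same integral
    against the kernel. Thus 1 - cos (w x) has mean at most 1 / N: this is the
    concentration of the kernel. *)
Lemma cosker_moment N b :
  N%:R * \int[mu]_(t in `[0, l]) ((1 - cos (w * (b - t))) * cosker l N (b - t))
  <= mass N.
Proof.
have w0 : w != 0 by rewrite /w gt_eqF// divr_gt0// mulr_gt0// pi_gt0.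
pose G x := cos (w * x) * cosker l N x.
pose M x := (1 - cos (w * x)) * cosker l N x.
pose F x := w^-1 * (sin (w * x) * cosker l N x).
have DF (x : R) : is_derive x 1 F (- N%:R * M x + G x).
  have Dk := is_derive_cosker N x.
  apply: is_derive_eq; rewrite /GRing.scale/= /G /M /cosker -/w.
  case: N {F G M Dk} => [|n]; first by rewrite !expr0; field.
  have E : sin (w * x) ^+ 2 = 1 - cos (w * x) ^+ 2 by rewrite -(cos2Dsin2 (w * x)); ring.
  rewrite [_.+1.-1]/= exprS.
  rewrite [LHS](_ : _ = (1 + cos (w * x)) ^+ n * (cos (w * x) * (1 + cos (w * x))
    - n.+1%:R * sin (w * x) ^+ 2)); last by field.
  by rewrite E; ring.
have Dc (x : R) : is_derive x 1 (fun y => cos (w * y)) (- w * sin (w * x)).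
  by apply: is_derive_eq; rewrite /GRing.scale/=; ring.
have cc := is_derive_continuous Dc.
have cM : continuous M.
  move=> x; apply: cvgM; last exact: cosker_continuous.
  by apply: cvgB; [exact: cvg_cst|exact: cc].
have cG : continuous G by move=> x; apply: cvgM; [exact: cc|exact: cosker_continuous].
have : \int[mu]_(t in `[0, l]) (- N%:R * M (b - t) + G (b - t)) = 0.
  rewrite (Rintegral_derive l0 _ (is_derive_reflect b DF)).
    rewrite subr0 /F -(cosker_periodic N (b - l)) subrK.
    have -> : sin (w * (b - l)) = sin (w * b).
      have -> : w * b = w * (b - l) + pi *+ 2.
        by rewrite -mulr_natl /w; field; rewrite gt_eqF.
      by rewrite sinD2pi.
    by rewrite subrr.
  apply: (@continuous_reflect (fun x => - N%:R * M x + G x)) => x.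
  by apply: cvgD; [apply: cvgM; [exact: cvg_cst|exact: cM]|exact: cG].
rewrite (Rintegral_lin _ _ _ (continuous_reflect cM) (continuous_reflect cG)).
rewrite mulNr addrC => /subr0_eq <-; rewrite -(smoothed_cst N b).
apply: (continuous_le_Rintegral (continuous_reflect cG)
  (continuous_reflect (@cosker_continuous N))) => x _.
by rewrite /G ler_piMl ?cosker_ge0 ?cos_le1.
Qed.

(** Away from the points b + z l the function 1 - cos (w (b - t)) is bounded
    from below, so a large multiple of it dominates f t - f b; near these points
    f t - f b is small. *)
Lemma periodic_lipschitz_cos_bound (f : R -> R) (b e : R) : 0 < e ->
  (forall x y, `|f x - f y| <= `|x - y|) -> periodic f l ->
  exists M, forall t, `|f t - f b| <= e + M * (1 - cos (w * (b - t))).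
Proof.
move=> e0 fL fl.
(* below half a period the minimum of 1 - cos beyond e is positive *)
wlog el : e e0 / e < l / 2.
  move=> H; have [/H//|le] := ltP e (l / 2); first exact.
  have l40 : 0 < l / 4 by move: l0; lra.
  have [|M HM] := H (l / 4) l40; first by move: l0; lra.
  exists M => t; apply: le_trans (HM t) _; move: le l0; lra.
have w0 : 0 < w by rewrite /w divr_gt0// mulr_gt0// pi_gt0.
have wl2 : w * (l / 2) = pi by rewrite /w; field; rewrite gt_eqF.
have we : w * e \in `[0, pi].
  by rewrite in_itv/= mulr_ge0 ?(ltW w0) ?(ltW e0)//= -wl2 ler_pM2l// ltW.
have m0 : 0 < 1 - cos (w * e).
  rewrite subr_gt0 -cos0 ltr_cos//; first exact: mulr_gt0.
  by rewrite in_itv/= lexx pi_ge0.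
exists (l / 2 / (1 - cos (w * e))) => t.
have cl : periodic (fun x => cos (w * x)) l by exact: cos_periodic.
have [z /andP[z0 zl]] := modr_period l0 (t - b + l / 2).
pose u := t - b - z%:~R * l.
have ul : `|u| <= l / 2 by rewrite /u ler_norml; move: z0 zl; lra.
have -> : f t = f (b + u) by rewrite -(periodic_int fl z t); congr f; rewrite /u; ring.
have -> : cos (w * (b - t)) = cos (w * `|u|).
  rewrite -cosN -mulrN opprB -[cos _](periodic_int cl z (t - b)) -/u.
  have [?|?] := ger0P u; first by [].
  by rewrite mulrN cosN.
have bu : `|f (b + u) - f b| <= `|u|.
  by rewrite (le_trans (fL _ _))// addrAC subrr add0r.
have cge0 : 0 <= 1 - cos (w * `|u|) by rewrite subr_ge0 cos_le1.
apply: (le_trans bu); have [ue|ue] := leP `|u| e.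
  by apply: (le_trans ue); rewrite lerDl mulr_ge0// !divr_ge0// ltW.
apply: (le_trans ul); apply: ler_wpDl; first exact: ltW.
rewrite mulrAC -mulrA ler_peMr//; first by move: l0; lra.
rewrite ler_pdivlMr// mul1r lerD2l lerN2.
have wu : w * `|u| <= pi by rewrite -wl2 ler_pM2l.
by rewrite ltW// ltr_cos ?ltr_pM2l// in_itv/= mulr_ge0 ?(ltW w0).
Qed.

Lemma smoothed_cvg (f : R -> R) (b : R) :
  (forall x y, `|f x - f y| <= `|x - y|) -> periodic f l ->
  smoothed N f b / mass N @[N --> \oo] --> f b.
Proof.
move=> fL fl.
have cf : continuous f by apply: (@lipschitz_continuous _ _ 1) => x y; rewrite mul1r.
(* the error splits into e / 2, from the bound near b, and M / N, from the rest *)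
apply/cvgrPdist_le => e e0.
have e20 : 0 < e / 2 by exact: divr_gt0.
have [M HM] := periodic_lipschitz_cos_bound b e20 fL fl.
near=> N.
have N0 : 0 < N%:R :> R by rewrite ltr0n; near: N; exact: nbhs_infty_gt.
have m0 := mass_gt0 N.
pose k t := cosker l N (b - t).
have ck : continuous k by apply: continuous_reflect; exact: cosker_continuous.
pose q t := (1 - cos (w * (b - t))) * k t.
have Dc (x : R) : is_derive x 1 (fun y => 1 - cos (w * (b - y))) (- w * sin (w * (b - x))).
  by apply: is_derive_eq; rewrite /GRing.scale/=; ring.
have cq : continuous q.
  by move=> x; apply: cvgM; [exact: (is_derive_continuous Dc)|exact: ck].
have fk0 : \int[mu]_(t in `[0, l]) ((f t - f b) * k t) = smoothed N f b - f b * mass N.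
  rewrite -(smoothed_cst N b) addrC -mulNr.
  rewrite -Rintegral_lin//; last by move=> x; apply: cvgM; [exact: cf|exact: ck].
  by apply: eq_Rintegral => t _; rewrite mulrBl addrC mulNr.
have cfk : continuous (fun t => (f t - f b) * k t).
  move=> x; apply: cvgM; last exact: ck.
  by apply: cvgB; [exact: cf|exact: cvg_cst].
have bnd : `|smoothed N f b - f b * mass N| <= e * mass N.
  rewrite -fk0; apply: (le_trans (le_normr_Rintegral _ _)) => //.
    exact: continuous_integrable.
  apply: (@le_trans _ _ (\int[mu]_(t in `[0, l]) (M * q t + e / 2 * k t))).
    apply: continuous_le_Rintegral => [x|x|x _].
    - by apply: cvg_norm; exact: cfk.
    - by apply: cvgD; apply: cvgM; [exact: cvg_cst|exact: cq|exact: cvg_cst|exact: ck].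
    rewrite normrM (ger0_norm (cosker_ge0 _ _)).
    have := ler_wpM2r (cosker_ge0 N (b - x)) (HM x).
    by rewrite /q /k; lra.
  have Mq : M * \int[mu]_(t in `[0, l]) q t <= e / 2 * mass N.
    apply: (@le_trans _ _ (`|M| * (mass N / N%:R))).
      apply: (@le_trans _ _ (`|M| * \int[mu]_(t in `[0, l]) q t)).
        apply: ler_wpM2r; last exact: ler_norm.
        by apply: Rintegral_ge0 => t _; rewrite /q /k mulr_ge0 ?cosker_ge0 ?subr_ge0 ?cos_le1.
      by rewrite ler_wpM2l// ler_pdivlMr// mulrC; exact: cosker_moment.
    rewrite mulrA mulrAC ler_pM2r// ler_pdivrMr// -ler_pdivrMl//.
    by rewrite ltW//; near: N; exact: nbhs_infty_gtr.
  rewrite Rintegral_lin//; last by move=> x; apply: cvgM; [exact: cvg_cst|exact: ck].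
  have -> : \int[mu]_(t in `[0, l]) (e / 2 * k t) = e / 2 * mass N.
    by rewrite RintegralZl ?smoothed_cst//; exact: continuous_integrable.
  by move: Mq; lra.
rewrite -[X in `|X - _|](mulfK (lt0r_neq0 m0)) -mulrBl normrM normfV.
by rewrite (gtr0_norm m0) ler_pdivrMr// distrC.
Unshelve. all: by end_near. Qed.
End cosker_estimates.

(** * Variation of the slopes of chords *)
Section average_variation.
Context {R : realType}.
Notation mu := (@lebesgue_measure R).
Variables (l C : R) (f : R -> R).
Hypothesis l0 : 0 < l.
Hypothesis fL : forall x y, `|f x - f y| <= `|x - y|.
Hypothesis fl : periodic f l.
Hypothesis weakBV : forall (xi : R -> R) (m : R), smooth xi -> periodic xi l ->
  (forall t, `|xi t| <= m) ->
  `|\int[mu]_(t in `[0, l]) (f t * derive1 (derive1 xi) t)| <= C * m.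

(** For a Lipschitz g, the mean of its derivative over [a, b]. *)
Definition slope (g : R -> R) (a b : R) := (g b - g a) / (b - a).

Lemma slope_MVT (g dg : R -> R) (a b : R) : (forall x : R, is_derive x 1 g (dg x)) ->
  a < b -> exists2 c, a <= c <= b & slope g a b = dg c.
Proof.
move=> D ab; have [] := @MVT _ g dg a b ab (fun z _ => D z).
  by apply: derivable_within_continuous => z _; case: (D z).
move=> z; rewrite in_itv/= => /andP[az zb] E; exists z; first by rewrite !ltW.
by rewrite /slope E mulfK// subr_eq0 gt_eqF.
Qed.

(** Used when g n.+1 - g 1 and g n - g 0 are both increments over a period: the
    windows [x j, x j.+2] cover the circle exactly twice. *)
Lemma sum_two_step (g : nat -> R) (n : nat) :
  \sum_(j < n) (g j.+2 - g j) = (g n.+1 - g 1%N) + (g n - g 0%N).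
Proof.
elim: n => [|n IH]; first by rewrite big_ord0; ring.
by rewrite big_ord_recr/= IH; ring.
Qed.

Variables (n : nat) (x a b a' b' : nat -> R).
Hypothesis xn : x n = x 0%N + l.
Hypothesis xn1 : x n.+1 = x 1%N + l.
Hypothesis ab : forall j, (j < n)%N -> [/\ x j <= a j, a j < b j & b j <= x j.+2].
Hypothesis ab' : forall j, (j < n)%N -> [/\ x j <= a' j, a' j < b' j & b' j <= x j.+2].

Let cf : continuous f.
Proof. by apply: (@lipschitz_continuous _ _ 1) => y z; rewrite mul1r. Qed.

Lemma smoothed_slope N (u v : R) :
  \int[mu]_(t in `[0, l]) (f t * slope (fun s => cosker l N (s - t)) u v) =
  slope (smoothed l N f) u v.
Proof.
have ck y : continuous (fun t => f t * cosker l N (y - t)).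
  move=> z; apply: cvgM; first exact: cf.
  exact: (continuous_reflect (@cosker_continuous _ l N)).
rewrite (_ : (fun t => _) = (fun t => (v - u)^-1 * (f t * cosker l N (v - t)) +
    (- (v - u)^-1 * (f t * cosker l N (u - t)) + 0))); last first.
  by apply/funext => t; rewrite /slope; ring.
rewrite !Rintegral_lin//.
- by rewrite Rintegral_cst//= mul0r /slope /smoothed; ring.
- by move=> z; exact: cvg_cst.
- move=> z; apply: cvgD; last exact: cvg_cst.
  by apply: cvgM; [exact: cvg_cst|exact: ck].
Qed.

(** Let B'' = A' be the kernel. The test function Xi t is the sum of the
    differences of the slopes of s |-> B (s - t) on the two intervals of each
    window, with the signs that make the second derivative of Xi integrate
    against f to the left-hand side. Moving t by a period changes all
    slopes of B by the same amount, so Xi is periodic. By the mean value theorem each slope is a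
    value of A in the window, and A is nondecreasing, so each difference is at
    most the increment of A over the window; the windows cover the circle twice,
    hence Xi is at most twice the mass of the kernel. *)
Lemma smoothed_slope_variation N :
  \sum_(j < n) `|slope (smoothed l N f) (a j) (b j) -
                 slope (smoothed l N f) (a' j) (b' j)| <= C * (2 * mass l N).
Proof.
have [A [B [sB DB DA]]] := cosker_antiderivatives l N.
have Ainc := antiderivative_increment l0 DA.
have Ahomo := antiderivative_homo DA.
pose m := mass l N.
have cK := @cosker_continuous _ l N.
pose S := smoothed l N f.
pose sig (j : 'I_n) : R := Num.sg (slope S (a j) (b j) - slope S (a' j) (b' j)).
pose D (F : R -> R) (j : 'I_n) t :=
  slope (fun s => F (s - t)) (a j) (b j) - slope (fun s => F (s - t)) (a' j) (b' j).
(* D B j is the j-th term of the test function, up to a sign; its derivatives are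
   - D A j and D j of the kernel *)
have DD (F dF : R -> R) (j : 'I_n) : (forall z : R, is_derive z 1 F (dF z)) ->
    forall t : R, is_derive t 1 (D F j) (- D dF j t).
  move=> DF t; rewrite /D /slope.
  have D1 := DF (a j - t); have D2 := DF (b j - t).
  have D3 := DF (a' j - t); have D4 := DF (b' j - t).
  apply: is_derive_eq; rewrite /GRing.scale/=; ring.
have Dcomb F j t : D F j t = (b j - a j)^-1 * F (b j - t) +
    (- (b j - a j)^-1 * F (a j - t) + (- (b' j - a' j)^-1 * F (b' j - t) +
    ((b' j - a' j)^-1 * F (a' j - t) + 0))).
  by rewrite /D /slope; ring.
pose Xi t := \sum_(j < n) sig j * D B j t.
pose dXi t := \sum_(j < n) sig j * - D A j t.
pose ddXi t := \sum_(j < n) sig j * D (cosker l N) j t.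
have DXi : forall t : R, is_derive t 1 Xi (dXi t).
  by apply: is_derive_lincomb => j z; exact: DD.
have DdXi : forall t : R, is_derive t 1 dXi (ddXi t).
  apply: (@is_derive_lincomb _ _ _ _ (fun j t => - D A j t)) => j z.
  have := DD A _ j DA z => D1; apply: is_derive_eq.
  by rewrite opprK.
have sXi : smooth Xi.
  apply: smooth_sum => j; rewrite (funext (Dcomb B j)).
  by do 4 (apply: smooth_lin; first exact: smooth_reflect); exact: smooth_cst.
have perD F (c k : R) (j : 'I_n) t : (forall y, F (y + l) = F y + k * y + c) ->
    D F j (t + l) = D F j t.
  move=> Fl; have E y : F (y - l) = F y - k * (y - l) - c.
    by rewrite -{2}(subrK l y) Fl; ring.
  have [_ abj _] := ab (ltn_ord j); have [_ abj' _] := ab' (ltn_ord j).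
  rewrite /D /slope !opprD !addrA !E; field.
  by rewrite !subr_eq0 !gt_eqF.
have BA y : B (y + l) = B y + m * y + (B l - B 0).
  have DH (z : R) : is_derive z 1 (fun y => B (y + l) - B y - m * y) 0.
    by apply: is_derive_eq; rewrite /GRing.scale/= /m -(Ainc z); ring.
  by have := is_derive_0_is_cst y 0 DH; rewrite add0r; lra.
have perXi : periodic Xi l.
  by move=> t; apply: eq_bigr => j _; rewrite (perD B (B l - B 0) m).
have [dK _ DK] := trigpolyX_derive (trigpolyW (cosker_trigpoly l N)).
have cDK j : continuous (D (cosker l N) j) by exact: is_derive_continuous (DD _ _ j DK).
have cddXi : continuous ddXi.
  exact: is_derive_continuous (is_derive_lincomb _ _ (fun j => DD _ _ j DK)).
have slopeA t u v y z : y <= u -> u < v -> v <= z ->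
    A (y - t) <= slope (fun s => B (s - t)) u v <= A (z - t).
  move=> yu uv vz.
  have DBt : forall s : R, is_derive s 1 (fun s => B (s - t)) (A (s - t)).
    move=> s; have := DB (s - t) => D1; apply: is_derive_eq.
    by rewrite /GRing.scale/=; ring.
  have [c /andP[uc cv] ->] := slope_MVT DBt uv.
  by apply/andP; split; apply: Ahomo; rewrite lerD2r; [exact: le_trans uc|exact: le_trans vz].
have bXi t : `|Xi t| <= 2 * m.
  apply: (@le_trans _ _ (\sum_(j < n) (A (x j.+2 - t) - A (x j - t)))).
    apply: (le_trans (ler_norm_sum _ _ _)); apply: ler_sum => j _.
    rewrite normrM; apply: (@le_trans _ _ (1 * `|D B j t|)).
      apply: ler_wpM2r => //; rewrite /sig normr_sg; by case: (_ != _).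
    rewrite mul1r ler_norml.
    have [xa abj bx] := ab (ltn_ord j); have [xa' abj' bx'] := ab' (ltn_ord j).
    have /andP[h1 h2] := slopeA t _ _ _ _ xa abj bx.
    have /andP[h3 h4] := slopeA t _ _ _ _ xa' abj' bx'.
    by rewrite /D; apply/andP; split; lra.
  rewrite (sum_two_step (fun j => A (x j - t))) xn xn1.
  by rewrite !(addrAC _ l) !Ainc /m; lra.
have := weakBV sXi perXi bXi.
rewrite (is_derive1E DXi) (is_derive1E DdXi).
suff -> : \int[mu]_(t in `[0, l]) (f t * ddXi t) =
  \sum_(j < n) `|slope S (a j) (b j) - slope S (a' j) (b' j)|.
  by rewrite ger0_norm// sumr_ge0.
have cfD j : continuous (fun t => f t * D (cosker l N) j t).
  by move=> z; apply: cvgM; [exact: cf|exact: cDK].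
rewrite (_ : (fun t => _) = (fun t => \sum_(j < n) sig j * (f t * D (cosker l N) j t))); last first.
  by apply/funext => t; rewrite /ddXi mulr_sumr; apply: eq_bigr => j _; ring.
rewrite Rintegral_sum//; apply: eq_bigr => j _.
rewrite normrEsg -/(sig j); congr (_ * _).
have cfs u v : continuous (fun t => f t * slope (fun s => cosker l N (s - t)) u v).
  move=> z; apply: cvgM; first exact: cf.
  apply: cvgM; last exact: cvg_cst.
  by apply: cvgB; exact: (continuous_reflect cK).
rewrite /S -!smoothed_slope addrC -mulN1r -Rintegral_lin//.
by apply: eq_Rintegral => t _; rewrite /D; ring.
Qed.

(** The derivative of f has bounded variation, stated through its means over
    intervals: pointwise values of the derivative never appear. This is the
    limit of [smoothed_slope_variation] as the kernel concentrates. *)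
Lemma slope_variation :
  \sum_(j < n) `|slope f (a j) (b j) - slope f (a' j) (b' j)| <= 2 * C.
Proof.
have cvg_slope u v : slope (smoothed l N f) u v / mass l N @[N --> \oo] --> slope f u v.
  rewrite /slope; under eq_fun do rewrite mulrAC mulrBl.
  by apply: cvgM; [apply: cvgB; exact: smoothed_cvg|exact: cvg_cst].
have cvgS : \sum_(j < n) `|slope (smoothed l N f) (a j) (b j) / mass l N -
     slope (smoothed l N f) (a' j) (b' j) / mass l N| @[N --> \oo] -->
  \sum_(j < n) `|slope f (a j) (b j) - slope f (a' j) (b' j)|.
  elim: (index_enum _) => [|j r IH].
    by under eq_fun do rewrite big_nil; rewrite big_nil; exact: cvg_cst.
  under eq_fun do rewrite big_cons; rewrite big_cons.
  by apply: cvgD => //; apply: cvg_norm; apply: cvgB; exact: cvg_slope.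
apply: (cvgr_to_le cvgS); apply: nearW => N.
have m0 := mass_gt0 l0 N.
rewrite -(ler_pM2r m0) mulr_suml; have := smoothed_slope_variation N.
rewrite (_ : C * _ = 2 * C * mass l N); last by ring.
apply: le_trans; apply: ler_sum => j _.
by rewrite -mulrBl normrM normfV (gtr0_norm m0) divfK ?gt_eqF.
Qed.

End average_variation.

(** * The Euclidean norm *)
Section euclidean_norm.
Context {R : realType}.
Implicit Types (u v : 'rV[R]_3) (k : R).

Lemma dotvE u v : dotv u v =
  u ord0 0 * v ord0 0 + u ord0 1 * v ord0 1 + u ord0 (lift ord0 1) * v ord0 (lift ord0 1).
Proof.
rewrite /dotv !big_ord_recl big_ord0 addr0 addrA.
by congr (_ + _ + _); congr (u _ _ * v _ _); exact: val_inj.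
Qed.

Lemma dotv_ge0 u : 0 <= dotv u u.
Proof. by rewrite /dotv sumr_ge0// => j _; rewrite -expr2 sqr_ge0. Qed.

Lemma enorm_ge0 u : 0 <= enorm u. Proof. exact: sqrtr_ge0. Qed.

Lemma sqr_enorm u : enorm u ^+ 2 = dotv u u.
Proof. by rewrite /enorm sqr_sqrtr// dotv_ge0. Qed.

(** Lagrange's identity: the defect is the squared norm of the cross product. *)
Lemma cauchy_schwarz u v : `|dotv u v| <= enorm u * enorm v.
Proof.
rewrite -(@ler_pXn2r _ 2)// ?nnegrE ?mulr_ge0 ?enorm_ge0//.
rewrite exprMn !sqr_enorm real_normK ?num_real// !dotvE.
set a := u _ _; set b := u _ _; set c := u _ _.
set d := v _ _; set e := v _ _; set f := v _ _.
rewrite -subr_ge0 (_ : _ - _ =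
  (a * e - b * d) ^+ 2 + (a * f - c * d) ^+ 2 + (b * f - c * e) ^+ 2); last by ring.
by rewrite !addr_ge0 ?sqr_ge0.
Qed.

Lemma enormZ k u : enorm (k *: u) = `|k| * enorm u.
Proof.
rewrite /enorm (_ : dotv _ _ = k ^+ 2 * dotv u u).
  by rewrite sqrtrM ?sqr_ge0// sqrtr_sqr.
by rewrite !dotvE !mxE; ring.
Qed.

Lemma ler_enormD u v : enorm (u + v) <= enorm u + enorm v.
Proof.
rewrite -(@ler_pXn2r _ 2)// ?nnegrE ?addr_ge0 ?enorm_ge0//.
rewrite sqrrD !sqr_enorm.
have -> : dotv (u + v) (u + v) = dotv u u + dotv u v *+ 2 + dotv v v.
  by rewrite !dotvE !mxE; ring.
by rewrite lerD2r lerD2l lerMn2r (le_trans (ler_norm _))// cauchy_schwarz.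
Qed.

Lemma enormN u : enorm (- u) = enorm u.
Proof. by rewrite -scaleN1r enormZ normrN1 mul1r. Qed.

Lemma enorm0 : enorm (0 : 'rV[R]_3) = 0.
Proof. by rewrite -(scale0r 0) enormZ normr0 mul0r. Qed.

Lemma ler_coord_enorm u c : `|u ord0 c| <= enorm u.
Proof.
rewrite -(@ler_pXn2r _ 2)// ?nnegrE ?enorm_ge0// sqr_enorm real_normK ?num_real//.
rewrite /dotv (bigD1 c)//= -expr2 lerDl sumr_ge0// => j _.
by rewrite -expr2 sqr_ge0.
Qed.

Lemma enorm_delta (c : 'I_3) : enorm (delta_mx ord0 c : 'rV[R]_3) = 1.
Proof.
rewrite /enorm (_ : dotv _ _ = 1) ?sqrtr1// /dotv (bigD1 c)//= !mxE !eqxx mulr1.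
rewrite big1 ?addr0// => j /negPf jc.
by rewrite !mxE eqxx jc mulr0.
Qed.

Lemma ler_enorm_coords u : enorm u <= \sum_(c < 3) `|u ord0 c|.
Proof.
rewrite {1}(row_sum_delta u); elim/big_ind2 : _ => [|a x b y ax bz|c _].
- by rewrite enorm0.
- by rewrite (le_trans (ler_enormD _ _))// lerD.
by rewrite enormZ enorm_delta mulr1.
Qed.

End euclidean_norm.

(** * Variation of the link-thickness *)
Section link_thickness.
Context {R : realType} {k : nat}.
Implicit Types f g : 'I_k -> R -> 'rV[R]_3.

(** Each distance between two components changes by at most 2 d, hence so does
    the infimum of these distances. *)
Lemma LThi_le f g (d : R) : 0 <= d -> (forall i s, enorm (f i s - g i s) <= d) ->
  LThi g <= LThi f + 2 * d.
Proof.
move=> d0 fg; rewrite /LThi.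
set Sf := (X in _ <= inf X + _); set Sg := (X in inf X <= _).
(* with fewer than two components both infima are 0 by default *)
have [[x0 Sx0]|Sf0] := pselect (Sf !=set0); last first.
  have -> : Sg = set0.
    rewrite -subset0 => x [i [j [ij [s [t _]]]]].
    by apply: Sf0; exists (enorm (f i s - f j t)), i, j; split => //; exists s, t.
  have -> : Sf = set0.
    by rewrite -subset0 => x Sx; apply: Sf0; exists x.
  by rewrite inf0 add0r mulr_ge0.
rewrite -lerBlDr; apply: lb_le_inf; first by exists x0.
move=> _ [i [j [ij [s [t ->]]]]]; rewrite lerBlDr.
apply: (@le_trans _ _ (enorm (g i s - g j t))).
  apply: ge_inf; last by exists i, j; split => //; exists s, t.
  by exists 0 => _ [? [? [_ [? [? ->]]]]]; exact: enorm_ge0.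
have -> : g i s - g j t = (f i s - f j t) + (- (f i s - g i s) + (f j t - g j t)).
  by apply/rowP => c; rewrite !mxE; ring.
rewrite (le_trans (ler_enormD _ _))// lerD2l.
rewrite (le_trans (ler_enormD _ _))// enormN.
by rewrite mulr_natl mulr2n lerD.
Qed.

Lemma var_LThi_ge (L : closed_curve R k) (xi : 'I_k -> R -> 'rV[R]_3) (d : R) :
  0 <= d -> (forall i s, enorm (xi i s) <= d) -> - (2 * d) <= var_LThi L xi.
Proof.
move=> d0 xid; rewrite /var_LThi.
(* without a limit, [lim] is 0, which satisfies the bound as well *)
set F := (X in lim X); have [cvF|/dvgP ->] := pselect (cvg F); last first.
  by rewrite oppr_le0 mulr_ge0.
apply: limr_ge => //.
near=> t; have t0 : 0 < t by near: t; exact: nbhs_right_gt.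
rewrite ler_pdivlMr// lerBrDr -lerBrDl.
have := @LThi_le (fun i s => Defs.comp L i s + t *: xi i s) (Defs.comp L) (t * d).
rewrite mulr_ge0 ?(ltW t0)// => /(_ isT); rewrite mulNr.
rewrite (_ : 2 * d * t = 2 * (t * d)) ?opprK; last by ring.
apply=> i s; rewrite addrAC subrr add0r enormZ (gtr0_norm t0).
by rewrite ler_wpM2l// ltW.
Unshelve. all: by end_near. Qed.

End link_thickness.

(** * The weak variation of the unit tangent of a strongly critical link *)
Section curves.
Context {R : realType} {k : nat} (L : closed_curve R k).
Notation mu := (@lebesgue_measure R).
Hypothesis hrect : rectifiable_by_arclength L.

Lemma enorm_chord_le i (a b : R) : enorm (Defs.comp L i b - Defs.comp L i a) <= `|b - a|.
Proof.
wlog ab : a b / a <= b.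
  move=> H; have [/H//|/ltW/H] := leP a b.
  by rewrite -enormN opprB distrC.
move: ab; rewrite le_eqVlt => /predU1P[->|ab]; first by rewrite !subrr enorm0 normr0.
rewrite (ger0_norm (_ : 0 <= b - a)) ?subr_ge0 ?(ltW ab)//.
suff : ((enorm (Defs.comp L i b - Defs.comp L i a))%:E <= (b - a)%:E)%E by rewrite lee_fin.
rewrite -(hrect i (ltW ab)).
apply: ereal_sup_ubound; exists [:: b]; first by split => //=; rewrite andbT.
by rewrite big_nat1.
Qed.

Definition curve_coord i (c : 'I_3) (s : R) : R := Defs.comp L i s ord0 c.

Lemma coord_lipschitz i c (a b : R) : `|curve_coord i c a - curve_coord i c b| <= `|a - b|.
Proof.
apply: le_trans (enorm_chord_le i b a).
by have := ler_coord_enorm (Defs.comp L i a - Defs.comp L i b) c; rewrite !mxE.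
Qed.

Lemma coord_periodic i c : periodic (curve_coord i c) (len L i).
Proof. by move=> s; rewrite /curve_coord comp_periodic. Qed.

(** Almost everywhere the three coordinates are derivable simultaneously, and
    there the derivative of the curve is computed coordinatewise. *)
Lemma unit_tangent_coord i c : {ae mu, forall s, 0 < s < len L i ->
  derivable (curve_coord i c) s 1 -> unit_tangent L i s ord0 c = derive1 (curve_coord i c) s}.
Proof.
have F := ae_filter_ringOfSetsType mu.
have H (c' : 'I_3) : {ae mu, forall s, 0 < s < len L i -> derivable (curve_coord i c') s 1}.
  have lip x y : `|curve_coord i c' x - curve_coord i c' y| <= 1 * `|x - y|.
    by rewrite mul1r coord_lipschitz.
  have [r [_ _ dr]] := lipschitz_density (len_gt0 L i) lip.
  by move: dr; apply: filterS => s /= ds /ds[].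
have := @filter_forall _ _ _ _ F H; apply: filterS => s /= ds sl _.
have dL : derivable (Defs.comp L i) s 1.
  by apply/derivable_mxP => j c'; rewrite ord1; exact: ds.
by rewrite /unit_tangent !derive1E derive_mx// !mxE.
Qed.

(** Deformation of a single coordinate of a single component: these fields are
    enough to control the tangent of every component. *)
Definition coord_field (i : 'I_k) (c : 'I_3) (xi : R -> R) : 'I_k -> R -> 'rV[R]_3 :=
  fun j s => (if j == i then xi s else 0) *: delta_mx ord0 c.

Lemma enorm_coord_field i c xi j s : enorm (coord_field i c xi j s) <= `|xi s|.
Proof.
rewrite /coord_field enormZ enorm_delta mulr1.
by case: eqP => _; rewrite ?normr0.
Qed.

Lemma smooth_coord_field i c xi : smooth xi -> periodic xi (len L i) ->
  smooth_field L (coord_field i c xi).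
Proof.
move=> sxi pxi j; rewrite /coord_field; have [->|ji] := eqVneq j i.
  by split; [move=> s; rewrite pxi|exact: smoothZ_row].
by split => //; apply: (@smoothZ_row _ 3 (fun=> 0)); exact: smooth_cst.
Qed.

Lemma periodic_derive1 (g : R -> R) (l : R) :
  (forall x, derivable g x 1) -> periodic g l -> periodic (derive1 g) l.
Proof.
move=> dg pg x.
have D (y : R) : is_derive y 1 g (derive1 g y).
  by apply: DeriveDef => //; rewrite derive1E.
have gE : (fun y => g (y + l)) = g by apply/funext => y; rewrite pg.
have : is_derive x 1 (fun y => g (y + l)) (derive1 g (x + l)).
  by have := D (x + l) => D1; apply: is_derive_eq; rewrite /GRing.scale/=; ring.
by rewrite gE => D2; rewrite [RHS]derive1E (@derive_val _ _ _ _ _ _ _ D2).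
Qed.

(** Integrating by parts removes the derivative of the curve, which exists only
    almost everywhere. *)
Lemma var_len_coord_field i c xi : smooth xi -> periodic xi (len L i) ->
  var_len L (coord_field i c xi) =
  - \int[mu]_(s in `[0, len L i]) (curve_coord i c s * derive1 (derive1 xi) s).
Proof.
move=> sxi pxi; have [dxi s1] := smoothP sxi; have [d1 s2] := smoothP s1.
have p1 := periodic_derive1 dxi pxi; have p2 := periodic_derive1 d1 p1.
have c2 := is_derive_continuous (smooth_is_derive s2).
have [M1 HM1] := periodic_continuous_bounded (len_gt0 L i) p1
  (is_derive_continuous (smooth_is_derive s1)).
have [M2 HM2] := periodic_continuous_bounded (len_gt0 L i) p2 c2.
have lip x y : `|curve_coord i c x - curve_coord i c y| <= 1 * `|x - y|.
  by rewrite mul1r coord_lipschitz.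
have [M0 HM0] := periodic_continuous_bounded (len_gt0 L i) (@coord_periodic i c)
  (lipschitz_continuous lip).
rewrite -(lipschitz_by_parts (len_gt0 L i) lip HM0 (smooth_is_derive s1) c2 HM1 HM2
  _ (@unit_tangent_coord i c)); last first.
  by rewrite -{1 2}(add0r (len L i)) p1 coord_periodic.
rewrite /var_len (bigD1 i)//= big1 ?addr0 => [|j ji].
  apply: eq_Rintegral => s _.
  have D := is_deriveZ_row (delta_mx ord0 c : 'rV[R]_3) (smooth_is_derive sxi s).
  have -> : derive1 (coord_field i c xi i) s = derive1 xi s *: delta_mx ord0 c.
    by rewrite derive1E /coord_field eqxx; exact: derive_val.
  rewrite /dotv (bigD1 c)//= !mxE !eqxx mulr1 big1 ?addr0// => j' /negPf jc.
  by rewrite !mxE eqxx jc !mulr0.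
have -> : coord_field i c xi j = cst 0.
  by apply/funext => y; rewrite /coord_field (negPf ji) scale0r.
transitivity (\int[mu]_(s in `[0, len L j]) (0 : R)).
  apply: eq_Rintegral => s _.
  by rewrite derive1_cst /dotv big1// => c' _; rewrite mxE mulr0.
by rewrite Rintegral_cst ?mul0r//; exact: measurable_itv.
Qed.

(** If the integral V is not zero, the field of xi / V changes the length at
    rate -1, so strong criticality makes the link-thickness vary by at most
    - eps, whereas a field bounded by m / |V| cannot make it vary by less than
    - 2 m / |V|. Comparing the two yields |V| <= (2 / eps) m. *)
Lemma strongly_critical_weakBV : strongly_critical L ->
  exists2 C : R, 0 <= C & forall i c (xi : R -> R) (m : R),
    smooth xi -> periodic xi (len L i) -> (forall t, `|xi t| <= m) ->
    `|\int[mu]_(t in `[0, len L i]) (curve_coord i c t * derive1 (derive1 xi) t)| <= C * m.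
Proof.
move=> [eps e0 crit]; exists (2 / eps); first by rewrite divr_ge0 ?ltW.
move=> i c xi m sxi pxi xim.
set V := \int[mu]_(t in _) _.
have m0 : 0 <= m by apply: le_trans (xim 0).
have [->|V0] := eqVneq V 0; first by rewrite normr0 !mulr_ge0 ?invr_ge0 ?(ltW e0).
pose zeta x := V^-1 * xi x + 0.
have szeta : smooth zeta := smooth_lin (c := V^-1) sxi (@smooth_cst R 0).
have pzeta : periodic zeta (len L i) by move=> x; rewrite /zeta pxi.
have zetam s : `|zeta s| <= m / `|V|.
  by rewrite /zeta addr0 normrM normfV mulrC ler_wpM2r.
have [dxi /smoothP[d1 s2]] := smoothP sxi.
have dz : derive1 (derive1 zeta) = (fun x => V^-1 * derive1 (derive1 xi) x).
  have D1 : derive1 zeta = (fun x => V^-1 * derive1 xi x).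
    apply: is_derive1E => x; have := smooth_is_derive sxi x => D.
    by apply: is_derive_eq; rewrite /GRing.scale/=; ring.
  have [_ s1] := smoothP sxi.
  rewrite D1; apply: is_derive1E => x; have := smooth_is_derive s1 x => D.
  by apply: is_derive_eq; rewrite /GRing.scale/=; ring.
have c2 : continuous (fun t => curve_coord i c t * derive1 (derive1 xi) t).
  move=> t; apply: cvgM; last exact: (is_derive_continuous (smooth_is_derive s2)).
  by apply: (@lipschitz_continuous _ _ 1) => x y; rewrite mul1r coord_lipschitz.
have vl : var_len L (coord_field i c zeta) = -1.
  rewrite (var_len_coord_field c szeta pzeta) dz; congr (- _).
  rewrite (_ : (fun s => _) =
    (fun t => V^-1 * (curve_coord i c t * derive1 (derive1 xi) t))); last first.
    by apply/funext => t; ring.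
  by rewrite RintegralZl ?mulVf//; exact: continuous_integrable.
have h1 := crit _ (smooth_coord_field c szeta pzeta) vl.
have h2 : - (2 * (m / `|V|)) <= var_LThi L (coord_field i c zeta).
  apply: var_LThi_ge; first by rewrite divr_ge0.
  by move=> j s; apply: le_trans (enorm_coord_field _ _ _ _ _) (zetam s).
have := le_trans h2 h1; rewrite lerN2 mulrA ler_pdivlMr ?normr_gt0// => h3.
by rewrite mulrAC ler_pdivlMr// mulrC.
Qed.

End curves.

(** * Turning angles *)
Section angles.
Context {R : realType}.
Implicit Types (u v : 'rV[R]_3) (k : R).

Lemma cos_ge_half (t : R) : 0 <= t <= pi / 4 -> 1 / 2 <= cos t.
Proof.
move=> /andP[t0 t4]; have p0 := pi_gt0 R.
have c4 : cos (pi / 4 : R) ^+ 2 = 1 / 2.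
  have := cos_mulr2n (pi / 4 : R).
  rewrite (_ : pi / 4 *+ 2 = pi / 2); last by rewrite -mulr_natr; field.
  by rewrite cos_pihalf; lra.
have c0 : 0 <= cos (pi / 4 : R).
  by apply: cos_ge0_pihalf; apply/andP; split; lra.
have ch : 1 / 2 <= cos (pi / 4 : R) by nra.
apply: (le_trans ch); move: t4; rewrite le_eqVlt => /predU1P[->//|t4].
by rewrite ltW// ltr_cos// in_itv/=; apply/andP; split; lra.
Qed.

(** Write sin t = 2 sin (t / 2) cos (t / 2): on [0, pi / 4] the cosine is at
    least 1 / 2, so by the mean value theorem sin (t / 2) is at least t / 4. *)
Lemma ler_quarter_sin (t : R) : 0 <= t <= pi / 2 -> t / 4 <= sin t.
Proof.
move=> /andP[t0 t2]; have p0 := pi_gt0 R.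
move: t0; rewrite le_eqVlt => /predU1P[<-|t0]; first by rewrite sin0 mul0r.
have h0 : 0 < t / 2 by lra.
have [] := @MVT R sin cos 0 (t / 2) h0 (fun x _ => is_derive_sin x).
  by apply: continuous_subspaceT; exact: continuous_sin.
move=> x; rewrite in_itv/= => /andP[x0 xt]; rewrite sin0 !subr0 => E.
have cx : 1 / 2 <= cos x by apply: cos_ge_half; apply/andP; split; lra.
have ct : 1 / 2 <= cos (t / 2) by apply: cos_ge_half; apply/andP; split; lra.
have -> : t = t / 2 + t / 2 by field.
have cc : 1 / 4 <= cos x * cos (t / 2) by nra.
rewrite sinD E; nra.
Qed.

Lemma cos_vangle_range u v : -1 <= dotv u v / (enorm u * enorm v) <= 1.
Proof.
rewrite -ler_norml normrM normfV (ger0_norm (mulr_ge0 (enorm_ge0 u) (enorm_ge0 v))).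
have [->|uv0] := eqVneq (enorm u * enorm v) 0; first by rewrite invr0 mulr0.
rewrite ler_pdivrMr ?mul1r ?cauchy_schwarz// lt_neqAle eq_sym uv0.
by rewrite mulr_ge0 ?enorm_ge0.
Qed.

Lemma vangle_le_pi u v : vangle u v <= pi.
Proof. by rewrite /vangle acos_lepi// cos_vangle_range. Qed.

Lemma vangleZ (h k : R) u v : 0 < h -> 0 < k ->
  vangle (h *: u) (k *: v) = vangle u v.
Proof.
move=> h0 k0; rewrite /vangle !enormZ !gtr0_norm//; congr acos.
have -> : dotv (h *: u) (k *: v) = h * k * dotv u v by rewrite !dotvE !mxE; ring.
by rewrite mulrACA -mulf_div mulfV ?mul1r// mulf_neq0 ?gt_eqF.
Qed.

(** With th the angle, |u| |v| (2 - 2 cos th) is at most |u - v|^2, while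
    1 - cos th = 2 sin^2 (th / 2). Without a lower bound on the norms, short
    vectors could make any angle. *)
Lemma vangle_le_dist u v : 1 / 2 <= enorm u -> 1 / 2 <= enorm v ->
  vangle u v <= 8 * enorm (u - v).
Proof.
move=> u1 v1; set th := vangle u v.
have p0 := pi_gt0 R.
have th0 : 0 <= th by rewrite /th /vangle acos_ge0// cos_vangle_range.
have thpi : th <= pi := vangle_le_pi u v.
have uv0 : 0 < enorm u * enorm v by apply: mulr_gt0; lra.
have costh : cos th * (enorm u * enorm v) = dotv u v.
  by rewrite /th /vangle acosK ?divfK ?gt_eqF// in_itv/= cos_vangle_range.
have half : cos th = 1 - 2 * sin (th / 2) ^+ 2.
  have {1}-> : th = (th / 2) *+ 2 by rewrite -mulr_natr; field.
  rewrite cos_mulr2n; have := cos2Dsin2 (th / 2); lra.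
have s4 : th / 2 / 4 <= sin (th / 2) by apply: ler_quarter_sin; apply/andP; split; lra.
have sd : sin (th / 2) <= enorm (u - v).
  rewrite -(@ler_pXn2r _ 2)// ?nnegrE ?enorm_ge0//; last by lra.
  have -> : enorm (u - v) ^+ 2 = enorm u ^+ 2 + enorm v ^+ 2 - 2 * dotv u v.
    by rewrite !sqr_enorm !dotvE !mxE; ring.
  rewrite -costh half; set s := sin _; set a := enorm u; set b := enorm v.
  have : 0 <= (a - b) ^+ 2 := sqr_ge0 _.
  have : 1 / 4 <= a * b by rewrite /a /b; nra.
  have : 0 <= s ^+ 2 := sqr_ge0 _.
  nra.
by lra.
Qed.

End angles.

(** * Inscribed polygons *)
Section cyclic_edges.
Variable T : Type.

Lemma zip_rot1 (x0 : T) (q : seq T) : (0 < size q)%N ->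
  zip q (rot 1 q) =
  mkseq (fun j => (nth x0 q j, nth x0 q (j.+1 %% size q))) (size q).
Proof.
case: q => // y q _; rewrite rot1_cons.
apply: (@eq_from_nth _ (x0, x0)).
  by rewrite size_zip size_rcons size_mkseq/= minnn.
move=> j; rewrite size_zip size_rcons/= minnn => jq.
rewrite nth_zip/= ?size_rcons// nth_mkseq//=; congr (_, _).
rewrite nth_rcons; move: jq; rewrite ltnS leq_eqVlt => /predU1P[->|jq].
  by rewrite ltnn eqxx modnn.
by rewrite jq modn_small.
Qed.

End cyclic_edges.

Section inscribed.
Context {R : realType}.

(** Enumeration of the parameters of the vertices continued beyond the last one
    by going around the circle again, so that edges and pairs of consecutive
    edges are indexed without a special case at the closing vertex. *)
Definition cyclic_point (l : R) (s : seq R) (j : nat) : R :=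
  nth 0 s (j %% size s) + (j %/ size s)%:R * l.

Lemma cyclic_point_shift l s j : (0 < size s)%N ->
  cyclic_point l s (j + size s) = cyclic_point l s j + l.
Proof.
by move=> s0; rewrite /cyclic_point modnDr divnDr// divnn s0 natrD mulrDl mul1r addrA.
Qed.

Lemma cyclic_point_lt l s j : 0 < l -> sorted <%R s ->
  {in s, forall x, 0 <= x < l} -> (0 < size s)%N ->
  cyclic_point l s j < cyclic_point l s j.+1.
Proof.
move=> l0 ss sl s0.
have [q [r [rs ->]]] : exists q r, (r < size s)%N /\ j = (r + q * size s)%N.
  by exists (j %/ size s)%N, (j %% size s)%N; rewrite ltn_mod addnC -divn_eq.
have H t : cyclic_point l s (t + q * size s) = cyclic_point l s t + q%:R * l.
  elim: q => [|q IH]; first by rewrite addn0 mul0r addr0.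
  rewrite mulSn (addnC (size s)) addnA cyclic_point_shift// IH -natr1; ring.
rewrite -addSn !H ltrD2r {H}.
rewrite /cyclic_point modn_small// divn_small// mul0r addr0.
have /andP[_ rl] : 0 <= nth 0 s r < l by apply: sl; exact: mem_nth.
have [r1|r1] := ltnP r.+1 (size s).
  rewrite modn_small// divn_small// mul0r addr0.
  by apply: (sorted_ltn_nth lt_trans) => //.
have -> : r.+1 = size s by apply/eqP; rewrite eqn_leq rs r1.
rewrite modnn divnn s0 mul1r.
have /andP[s00 _] : 0 <= nth 0 s 0 < l by apply: sl; exact: mem_nth.
by lra.
Qed.

Lemma polygon_curvatureE (f : R -> 'rV[R]_3) (l : R) (s : seq R) :
  periodic f l -> (0 < size s)%N ->
  let x := cyclic_point l s in
  polygon_curvature [seq f x | x <- s] =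
  \sum_(j < size s) vangle (f (x j.+1) - f (x j)) (f (x j.+2) - f (x j.+1)).
Proof.
move=> fl s0 x; set p := map f s.
have fx j : f (x j) = nth 0 p (j %% size s).
  rewrite /p (nth_map 0) ?ltn_mod// /x /cyclic_point.
  elim: (j %/ size s)%N => [|q IH]; first by rewrite mul0r addr0.
  by rewrite -natr1 mulrDl mul1r addrA fl.
have sp : size p = size s by rewrite size_map.
have E : edges p = mkseq (fun j => f (x j.+1) - f (x j)) (size s).
  rewrite /edges (@zip_rot1 _ 0) ?sp// /mkseq -map_comp.
  apply/eq_in_map => j; rewrite mem_iota => /andP[_ js] /=.
  by rewrite !fx (modn_small js).
rewrite /polygon_curvature (@zip_rot1 _ 0) E ?size_mkseq//.
rewrite /mkseq big_map -{1}(subn0 (size s)) -/(index_iota 0 (size s)) big_mkord.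
apply: eq_bigr => j _ /=.
rewrite !(nth_map 0%N) ?size_iota ?ltn_mod// !nth_iota ?ltn_mod// !add0n.
congr vangle; rewrite !fx.
by rewrite modn_mod -[(_ %% _).+1]addn1 modnDml addn1.
Qed.

Lemma edge_slope (f : R -> 'rV[R]_3) (a b : R) : a < b ->
  f b - f a = (b - a) *: ((b - a)^-1 *: (f b - f a)).
Proof. by move=> ab; rewrite scalerA mulfV ?scale1r// subr_eq0 gt_eqF. Qed.

End inscribed.

(** * The bound on the total curvature *)
Section total_curvature_bound.
Context {R : realType} {k : nat} (L : closed_curve R k).
Notation mu := (@lebesgue_measure R).
Hypothesis hrect : rectifiable_by_arclength L.

(** Mean of the unit tangent over the arc from a to b. *)
Definition vslope (f : R -> 'rV[R]_3) (a b : R) := (b - a)^-1 *: (f b - f a).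

(** Otherwise every inscribed polygonal line would have length at most 3 / 4 of
    the length b - a of the arc. *)
Lemma steep_subarc i (a b : R) : a < b -> exists cd : R * R,
  [/\ a <= cd.1, cd.1 < cd.2, cd.2 <= b &
      3 / 4 <= enorm (vslope (Defs.comp L i) cd.1 cd.2)].
Proof.
move=> ab; apply: contrapT => H.
have short c d : a <= c -> c < d -> d <= b ->
    enorm (Defs.comp L i d - Defs.comp L i c) <= 3 / 4 * (d - c).
  move=> ac cd db; rewrite leNgt; apply/negP => h; apply: H; exists (c, d); split => //=.
  rewrite /vslope enormZ normfV gtr0_norm ?subr_gt0// ler_pdivlMl ?subr_gt0//.
  by rewrite mulrC ltW.
have := hrect i (ltW ab); apply/eqP; rewrite lt_eqF//.
apply: (@le_lt_trans _ _ (3 / 4 * (b - a))%:E); last by rewrite lte_fin; lra.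
apply: ge_ereal_sup => _ [s abs <-]; rewrite lee_fin.
pose g n := nth b (a :: s) n.
have s0 : (0 < size s)%N.
  by case: (s) abs => // /itv_partition_nil E; move: ab; rewrite E ltxx.
have [ps /eqP sb] := abs.
apply: (@le_trans _ _ (\sum_(0 <= n < size s) 3 / 4 * (g n.+1 - g n))).
  rewrite !big_nat; apply: ler_sum => n /andP[_ ns]; apply: short.
  - by apply: itv_partition_nth_ge abs; rewrite ltnS ltnW.
  - by move/(pathP b) : ps; exact.
  - exact: itv_partition_nth_le abs.
rewrite -mulr_sumr telescope_sumr//; apply: ler_wpM2l; first by lra.
by rewrite /g nth0 (_ : nth b (a :: s) (size s) = b)// -[in RHS]sb (last_nth b).
Qed.

Variable C : R.
Hypothesis weakBV : forall i c (xi : R -> R) (m : R),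
  smooth xi -> periodic xi (len L i) -> (forall t, `|xi t| <= m) ->
  `|\int[mu]_(t in `[0, len L i]) (curve_coord L i c t * derive1 (derive1 xi) t)| <= C * m.

Lemma vslope_variation i (n : nat) (x a b a' b' : nat -> R) :
  x n = x 0%N + len L i -> x n.+1 = x 1%N + len L i ->
  (forall j, (j < n)%N -> [/\ x j <= a j, a j < b j & b j <= x j.+2]) ->
  (forall j, (j < n)%N -> [/\ x j <= a' j, a' j < b' j & b' j <= x j.+2]) ->
  \sum_(j < n) enorm (vslope (Defs.comp L i) (a j) (b j) -
                      vslope (Defs.comp L i) (a' j) (b' j)) <= 6 * C.
Proof.
move=> xn xn1 ab ab'.
apply: (@le_trans _ _ (\sum_(j < n) \sum_(c < 3)
   `|slope (curve_coord L i c) (a j) (b j) - slope (curve_coord L i c) (a' j) (b' j)|)).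
  apply: ler_sum => j _; apply: le_trans (ler_enorm_coords _) _.
  apply: ler_sum => c _.
  by rewrite /vslope /slope /curve_coord !mxE [_ / _]mulrC [_ / (b' j - _)]mulrC.
rewrite exchange_big/=.
apply: (@le_trans _ _ (\sum_(c < 3) 2 * C)).
  apply: ler_sum => c _.
  exact: (slope_variation (len_gt0 L i) (coord_lipschitz hrect i c)
    (coord_periodic L i c) (@weakBV i c) xn xn1 ab ab').
rewrite sumr_const card_ord -mulr_natl; lra.
Qed.

(** Let m j be the mean tangent along the j-th edge and m' j that along a subarc
    given by [steep_subarc]. If m j and m j.+1 have norm at least 1 / 2, the
    turning angle is at most 8 |m j - m j.+1|. Otherwise one of them, say m j,
    has |m j - m' j| >= 1 / 4, and the angle, at most pi, is at most
    4 pi |m j - m' j|. The three sums that arise are variations of mean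
    tangents. *)
Lemma polygon_curvature_bound i p :
  inscribed_polygons (Defs.comp L i) (len L i) p ->
  polygon_curvature p <= (48 + 48 * pi) * C.
Proof.
move=> [s [ss sl -> _]]; set f := Defs.comp L i; set l := len L i.
have l0 := len_gt0 L i.
have C0 : 0 <= C.
  have := @weakBV i ord0 (fun=> 0) 1 (@smooth_cst R 0) (fun=> erefl).
  rewrite mulr1; move=> H; apply: le_trans (H _) => // t.
  by rewrite normr0.
have p0 := pi_gt0 R.
have [s0|s0] := posnP (size s).
  rewrite (size0nil s0) /polygon_curvature big_nil mulr_ge0//; lra.
rewrite (@polygon_curvatureE _ f l)//; last exact: comp_periodic.
set x := cyclic_point l s; set n := size s.
have xlt j : x j < x j.+1 by exact: cyclic_point_lt.
have xn : x n = x 0%N + l by rewrite -(cyclic_point_shift l 0 s0).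
have xn1 : x n.+1 = x 1%N + l by rewrite -(cyclic_point_shift l 1 s0).
have [cd cdP] := choice (fun j => steep_subarc i (xlt j)).
pose m j := vslope f (x j) (x j.+1).
pose m' j := vslope f (cd j).1 (cd j).2.
pose d j := enorm (m j - m' j).
have xle j : x j <= x j.+1 := ltW (xlt j).
have S1 : \sum_(j < n) enorm (m j - m j.+1) <= 6 * C.
  apply: (@vslope_variation i n x x (fun j => x j.+1) (fun j => x j.+1)
    (fun j => x j.+2)) => // j _; split=> //.
have S2 : \sum_(j < n) d j <= 6 * C.
  apply: (@vslope_variation i n x x (fun j => x j.+1) (fun j => (cd j).1)
    (fun j => (cd j).2)) => // j _; split=> //; have [] := cdP j => // h1 h2 h3 _.
  exact: le_trans h3 _.
have S3 : \sum_(j < n) d j.+1 <= 6 * C.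
  apply: (@vslope_variation i n x (fun j => x j.+1) (fun j => x j.+2)
    (fun j => (cd j.+1).1) (fun j => (cd j.+1).2)) => // j _; split=> //;
    have [] := cdP j.+1 => // h1 h2 h3 _.
  exact: le_trans h1.
have flat j : enorm (m j) < 1 / 2 -> 1 <= 4 * d j.
  move=> mj; have [_ _ _ h] := cdP j.
  have : enorm (m' j) <= enorm (m j) + d j.
    rewrite (_ : m' j = m j + - (m j - m' j)); last by rewrite opprB addrC subrK.
    by rewrite (le_trans (ler_enormD _ _))// enormN.
  by move: h; rewrite -/f -/(m' j); lra.
have d0 j : 0 <= d j by exact: enorm_ge0.
apply: (@le_trans _ _ (\sum_(j < n)
    (8 * enorm (m j - m j.+1) + (4 * pi * d j + 4 * pi * d j.+1)))).
  apply: ler_sum => j _.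
  rewrite (edge_slope f (xlt j)) (edge_slope f (xlt j.+1)).
  rewrite vangleZ ?subr_gt0// -/(vslope f _ _) -/(vslope f _ _) -/(m j) -/(m j.+1).
  have e0 : 0 <= enorm (m j - m j.+1) by exact: enorm_ge0.
  have vp := vangle_le_pi (m j) (m j.+1).
  have := d0 j; have := d0 j.+1.
  have [/flat h|h1] := ltP (enorm (m j)) (1 / 2); first by nra.
  have [/flat h|h2] := ltP (enorm (m j.+1)) (1 / 2); first by nra.
  by have := vangle_le_dist h1 h2; nra.
have q0 : 0 <= 4 * pi :> R by lra.
have h2 := ler_wpM2l q0 S2; have h3 := ler_wpM2l q0 S3.
by rewrite !big_split/= -!mulr_sumr; lra.
Qed.

End total_curvature_bound.

Theorem corollary6p2 (R : realType) (k : nat) (L : closed_curve R k)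
    (hlink : is_link L) (hrect : rectifiable_by_arclength L)
    (hcrit : strongly_critical L) :
  (total_curvature L < +oo)%E.
Proof.
have [C _ weakBV] := strongly_critical_weakBV hrect hcrit.
rewrite /total_curvature; apply: lte_sum_pinfty => i _.
apply: (@le_lt_trans _ _ ((48 + 48 * pi) * C)%:E); last exact: ltry.
apply: ge_ereal_sup => _ [p pL <-]; rewrite lee_fin.
exact: (polygon_curvature_bound hrect weakBV pL).
Qed.
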